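(* For integers $n\ge 2$ and $0\le k\le n-2$, there is a bijection \[ \mathcal{I}_{n,k}(3241,4321)\longrightarrow \mathcal{I}_{n-k}(321)\times \mathcal{C}_{k,\,n-k-2}. \]
   Context: Permutations of $[n]=\{1,\dots,n\}$ are written in one-line notation $p=p_1\cdots p_n$. A permutation avoids a pattern $\sigma$ if it has no subsequence order-isomorphic to $\sigma$. A permutation of $[n]$, $n\ge1$, is indecomposable if there is no $k$ with $1\le k\le n-1$ such that $\{p_1,\dots,p_k\}=\{1,\dots,k\}$. An entry of $p$ is blue if it plays the role of the ''2'' in some occurrence of the pattern $321$ or of the pattern $4312$ in $p$ (i.e. it is $p_j$ in $p_i>p_j>p_k$ with $i<j<k$, or it is $p_l$ in an occurrence $p_ip_jp_kp_l$, $i<j<k<l$, order-isomorphic to $4312$). $\mathcal{I}_n(3241,4321)$ is the set of indecomposable permutations of $[n]$ avoiding both $3241$ and $4321$, and $\mathcal{I}_{n,k}(3241,4321)$ is the subset of those having exactly $k$ blue entries. $\mathcal{I}_r(321)$ is the set of indecomposable $321$-avoiding permutations of $[r]$. For integers $k,r\ge0$, $\mathcal{C}_{k,r}$ is the set of integer sequences $(a_1,\dots,a_k)$ with $1\le a_1\le r+1$ and $1\le a_i\le a_{i-1}+1$ for $2\le i\le k$ (for $k=0$ it consists of the empty sequence). *)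

(* Defs.v *)
(* Permutations of [n] are modeled as {perm 'I_n}:
   positions and values are shifted down by one (0..n-1). *)
From mathcomp Require Import all_boot all_fingroup.
Set Implicit Arguments. Unset Strict Implicit. Unset Printing Implicit Defensive.

Definition occurrence (n : nat) (p : {perm 'I_n}) (sigma : seq nat)
    (idx : seq 'I_n) : bool :=
  [&& size idx == size sigma,
      sorted ltn (map val idx) &
      all (fun i => all (fun j =>
          (nth 0 [seq val (p x) | x <- idx] i < nth 0 [seq val (p x) | x <- idx] j)
            == (nth 0 sigma i < nth 0 sigma j))
        (iota 0 (size sigma))) (iota 0 (size sigma))].

Definition contains (n : nat) (p : {perm 'I_n}) (sigma : seq nat) : bool :=
  [exists t : (size sigma).-tuple 'I_n, occurrence p sigma t].

Definition avoids (n : nat) (p : {perm 'I_n}) (sigma : seq nat) : bool :=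
  ~~ contains p sigma.

(* indecomposable: n >= 1 and no 1 <= k <= n-1 with {p_1..p_k} = {1..k};
   with 0-based indices the latter says p maps positions < k onto values < k. *)
Definition indecomposable (n : nat) (p : {perm 'I_n}) : bool :=
  (0 < n) &&
  [forall k : 'I_n, (0 < val k) ==>
     ~~ [forall i : 'I_n, (val i < val k) ==> (val (p i) < val k)]].

(* position j carries a blue entry: p_j is the "2" of some 321-occurrence
   (middle position) or the "2" of some 4312-occurrence (last position). *)
Definition blue (n : nat) (p : {perm 'I_n}) (j : 'I_n) : bool :=
  [exists t : 3.-tuple 'I_n,
      occurrence p [:: 3; 2; 1] t && (nth 0 [seq val x | x <- t] 1 == val j)]
  || [exists t : 4.-tuple 'I_n,
      occurrence p [:: 4; 3; 1; 2] t && (nth 0 [seq val x | x <- t] 3 == val j)].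

Definition nblue (n : nat) (p : {perm 'I_n}) : nat := #|[set j | blue p j]|.

Definition inI_3241_4321 (n : nat) (p : {perm 'I_n}) : bool :=
  [&& indecomposable p, avoids p [:: 3; 2; 4; 1] & avoids p [:: 4; 3; 2; 1]].

Definition inI_nk (n k : nat) (p : {perm 'I_n}) : bool :=
  inI_3241_4321 p && (nblue p == k).

Definition inI_321 (r : nat) (q : {perm 'I_r}) : bool :=
  indecomposable q && avoids q [:: 3; 2; 1].

Definition inC (k r : nat) (a : k.-tuple nat) : bool :=
  [forall i : 'I_k,
     (0 < tnth a i) &&
     (if val i is i'.+1 then tnth a i <= (nth 0 a i').+1
      else tnth a i <= r.+1)].

(* Main.v *)
(** Removing the left-to-right maxima of a permutation [p] in the class leaves a
    321-avoiding word; its indecomposable components occupy contiguous positions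
    of [p], and the blue entries are exactly the entries that are not the minimum
    of their component.

    Let [p] have length at least 2 and first entry [v].  The rest of [p] is a direct
    sum [Z (+) Q] with [Q] indecomposable, and [v] exceeds all of [Z].  Either [v] is
    the maximum and the rest is any 321-avoiding permutation, or [Z] avoids 321,
    [Q] is in the class, and [v] cuts the values of [Q] at an admissible height,
    which is at most the first entry of [Q].  In both cases the numbers of blue
    entries and of admissible heights of [p] are read off those of the pieces.
    With [t] marking the length and [y] the blue entries this becomes a linear
    system for functionals [f |-> sum t^n y^k f(#heights)], whose solution is
    geometric in the number of heights: if [C = 1 + t y C^2] and
    [D = 1 + t C D^2], the generating function of the class is [t D].  Expanding,
    there are [c(r-1, 1) c(k, r-1)] permutations with [r] non-blue and [k] blue
    entries, where [c(k, j)] is the coefficient of [z^k] in the [j]-th power of the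
    Catalan series; [k = 0] counts the indecomposable 321-avoiding permutations and
    [c(k, r-1)] is the size of [C_{k,r-2}]. *)
Require Import Defs.
From mathcomp Require Import all_boot all_fingroup all_algebra zify ring boolp.
Set Implicit Arguments. Unset Strict Implicit. Unset Printing Implicit Defensive.
Import GRing.Theory.

(** * Linear systems over a ring with a nilpotent parameter *)

Section Nilpotent.
Local Open Scope ring_scope.

(** Substituting the equation into the difference of the two solutions gains a factor [t], so the
    difference is divisible by every power of [t], hence zero. *)
Lemma nilpotent_fixpoint_unique (R : comNzRingType) (M n : nat) (t : R)
    (A : (nat -> R) -> R) (w : nat -> R) (T : nat -> (nat -> R) -> nat -> R)
    (F G : (nat -> R) -> R) :
  t ^+ M = 0 ->
  (forall f, F f = A f + t * \sum_(a < n) w a * F (T a f)) ->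
  (forall f, G f = A f + t * \sum_(a < n) w a * G (T a f)) ->
  forall f, F f = G f.
Proof.
move=> tM HF HG f; apply/eqP; rewrite -subr_eq0; apply/eqP.
suff dvd j : forall f, exists r, F f - G f = t ^+ j * r.
  by case: (dvd M f) => r ->; rewrite tM mul0r.
elim: j => [|j IH] {}f; first by exists (F f - G f); rewrite expr0 mul1r.
have [r Hr] : exists r, \sum_(a < n) w a * (F (T a f) - G (T a f)) = t ^+ j * r.
  apply: (big_ind (fun x => exists r, x = t ^+ j * r)) => [|x y [r1 ->] [r2 ->]|a _].
  - by exists 0; rewrite mulr0.
  - by exists (r1 + r2); rewrite mulrDr.
  - by have [r ->] := IH (T a f); exists (w a * r); ring.
exists r; rewrite HF HG exprS -mulrA -Hr opprD addrACA subrr add0r -mulrBr -sumrB.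
by congr (_ * _); apply: eq_bigr => a _; rewrite mulrBr.
Qed.

Lemma sum_shift_ord (R : comNzRingType) (M a d : nat) (f : nat -> R) :
  (a + d < M)%N ->
  \sum_(x < d) f (a + x.+1)%N = \sum_(e < M | (a < e <= a + d)%N) f e.
Proof.
elim: d => [_|d IH adM]; first by rewrite big_ord0 big_pred0 // => e; lia.
rewrite big_ord_recr /= IH; last by lia.
rewrite [RHS](bigD1 (Ordinal adM)) /=; last by lia.
by rewrite addrC; congr (_ + _); apply: eq_bigl => e; rewrite -val_eqE /=; lia.
Qed.

(** * Two fixed-point equations with geometric solutions *)

Section Solve.

Variables (R : comNzRingType) (M : nat) (t k : R).
Hypothesis tM : t ^+ M.+1 = 0.

(* [omega] and [nu] are the coefficients of the solutions: [1 + t z / (1 - h z)] with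
   [h = t + t k], and [1 + t cc z / (1 - g z)] with [g = t k + t cc]. *)
Definition omega (a : nat) : R := if a is b.+1 then t * (t + t * k) ^+ b else 1.

(** This and [nu_dvd] make truncation at [M] exact: products whose indices add up to more than [M]
    vanish. *)
Lemma omega_dvd a : exists r, omega a = t ^+ a * r.
Proof.
case: a => [|a]; first by exists 1; rewrite mulr1.
by exists ((1 + k) ^+ a); rewrite /= exprS -mulrA -exprMn mulrDr mulr1.
Qed.

Lemma expt_ge j : (M < j)%N -> t ^+ j = 0.
Proof. by move=> lj; rewrite -(subnK lj) exprD tM mulr0. Qed.

(** By uniqueness only the candidate has to be checked. The coefficient of [g e.+1] requires that
    omega(e+1) be t times the sum over a <= e of omega(a) (t k)^(e-a). *)
Lemma omega_solve (W : (nat -> R) -> R) :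
  (forall g, W g = g 0 + t * W (fun a => \sum_(d < M.+1) (t * k) ^+ d * g (a + d.+1)%N)) ->
  forall g, W g = \sum_(a < M.+1) omega a * g a.
Proof.
move=> HW.
apply: (@nilpotent_fixpoint_unique R M.+1 1 t (fun g => g 0) (fun _ => 1)
  (fun _ g a => \sum_(d < M.+1) (t * k) ^+ d * g (a + d.+1)%N)) => // g.
  by rewrite big_ord1 mul1r -HW.
rewrite big_ord1 mul1r.
under [X in t * X]eq_bigr => a _ do rewrite mulr_sumr.
rewrite big_ord_recl mul1r; congr (_ + _).
(* Terms are regrouped by e = a + d. Those with a + d >= M vanish, since
   [t * omega a * (t * k) ^+ d] is divisible by [t ^+ (a + d).+1]. *)
transitivity (t * \sum_(a < M.+1) \sum_(d < M.+1) \sum_(e < M | e == (a + d)%N :> nat)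
   omega a * (t * k) ^+ d * g e.+1); last first.
  rewrite !mulr_sumr; apply: eq_bigr => a _; rewrite !mulr_sumr; apply: eq_bigr => d _.
  case: (ltnP (a + d) M) => adM.
    rewrite (big_pred1 (Ordinal adM)) /=; first by rewrite !mulrA addnS.
    by move=> e; rewrite /= -val_eqE.
  rewrite big_pred0 => [|e]; last by apply/eqP; have := ltn_ord e; lia.
  have [r ->] := omega_dvd a.
  have : t * t ^+ a * t ^+ d = 0 by rewrite -exprS -exprD expt_ge //; lia.
  move=> t0; rewrite mulr0 exprMn.
  transitivity (t * t ^+ a * t ^+ d * (r * k ^+ d * g (a + d.+1)%N)); last by ring.
  by rewrite t0 mul0r.
under [X in _ = _ * X]eq_bigr => a _ do rewrite (exchange_big_dep predT) //=.
rewrite exchange_big mulr_sumr; apply: eq_bigr => e _.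
rewrite lift0 /= -mulrA; congr (_ * _).
transitivity (\sum_(a < M.+1 | (a < e.+1)%N) omega a * (t * k) ^+ (e - a) * g e.+1).
  rewrite -big_distrl /=; congr (_ * _).
  rewrite -(big_ord_widen M.+1 (fun a => omega a * (t * k) ^+ (e - a))); last by have := ltn_ord e; lia.
  move: (nat_of_ord e) => {}e; elim: e => [|e IH]; first by rewrite big_ord1 mulr1.
  rewrite big_ord_recr /= subnn mulr1 exprS.
  under [X in _ = X + _]eq_bigr => a _ do rewrite (subSn (ltn_ord a : a <= e)%N) exprS mulrCA.
  by rewrite -mulr_sumr -IH; ring.
rewrite [LHS]big_mkcond; apply: eq_bigr => a _ /=.
case: ltnP => ae.
  have h : (e - a < M.+1)%N by have := ltn_ord e; lia.
  rewrite (big_pred1 (Ordinal h)) //= => d; rewrite /= -val_eqE /=; lia.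
by rewrite big_pred0 // => d; lia.
Qed.

Variables (cc J : R).
Let g := t * k + t * cc.
Hypotheses (gJ : (1 - g) * J = 1) (ccJ : cc - 1 = t * cc * J).

Definition nu (d : nat) : R := if d is b.+1 then t * cc * g ^+ b else 1.

Lemma nu_dvd d : exists r, nu d = t ^+ d * r.
Proof.
case: d => [|d]; first by exists 1; rewrite mulr1.
exists (cc * (k + cc) ^+ d).
by rewrite /= /g -mulrDr exprMn exprS; ring.
Qed.

(** A geometric tail: its sum is t cc g^x / (1 - g), and [J] inverts [1 - g]. Stopping at [M] loses
    nothing. *)
Lemma nu_tail x : \sum_(d < M.+1 | (x < d)%N) nu d = (cc - 1) * g ^+ x.
Proof.
have tg j : (M <= j)%N -> t * g ^+ j = 0.
  by move=> Mj; rewrite /g -mulrDr exprMn mulrA -exprS expt_ge // mul0r.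
case: (leqP x M) => xM; last first.
  rewrite big_pred0 => [|d]; last by have := ltn_ord d; lia.
  transitivity (t * g ^+ x * (cc * J)); last by rewrite ccJ; ring.
  by rewrite tg ?mul0r //; lia.
(* Multiplied by [1 - g] the tail telescopes. The induction goes downward from [x = M], where the
   sum is empty. *)
suff E : (\sum_(d < M.+1 | (x < d)%N) nu d) * (1 - g) = t * cc * g ^+ x.
  by rewrite ccJ mulrAC -E -mulrA gJ mulr1.
elim: {x}(M - x)%N {-2}x xM (erefl (M - x)%N) => [|n IH] x xM En.
  rewrite big_pred0 => [|d]; last by have := ltn_ord d; lia.
  by rewrite mul0r mulrAC tg ?mul0r //; lia.
have xM1 : (x.+1 < M.+1)%N by lia.
rewrite (bigD1 (Ordinal xM1)) //= mulrDl.
rewrite (eq_bigl (fun d : 'I_M.+1 => (x.+1 < d)%N)) => [|d]; last by rewrite -val_eqE /=; lia.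
by rewrite IH ?exprS; [ring|lia|lia].
Qed.

(** On the right, the coefficient of [f e] collects for each a < e all [nu d] with d >= e - a, a
    tail evaluated by [nu_tail]. *)
Lemma nu_solve (V : (nat -> R) -> R) :
  (forall f, V f = \sum_(a < M.+1) omega a * f a
     + t * \sum_(a < M.+1) omega a * V (fun d => \sum_(x < d) f (a + x.+1)%N)) ->
  forall f, V f = \sum_(d < M.+1) nu d * f d.
Proof.
move=> HV.
apply: (@nilpotent_fixpoint_unique R M.+1 M.+1 t
  (fun f => \sum_(a < M.+1) omega a * f a) omega
  (fun a f d => \sum_(x < d) f (a + x.+1)%N)) => // f.
transitivity (\sum_(a < M.+1) omega a * f a + t * \sum_(a < M.+1) \sum_(d < M.+1)
  \sum_(e < M.+1 | (a < e <= a + d)%N) omega a * nu d * f e); last first.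
  congr (_ + _ * _); apply: eq_bigr => a _; rewrite mulr_sumr; apply: eq_bigr => d _.
  rewrite mulrA -mulr_sumr; case: (ltnP (a + d) M.+1) => adM; first by rewrite (sum_shift_ord _ adM).
  suff -> : omega a * nu d = 0 by rewrite !mul0r.
  have [r ->] := omega_dvd a; have [q ->] := nu_dvd d.
  by rewrite mulrACA -exprD expt_ge ?mul0r.
under [X in _ = _ + _ * X]eq_bigr => a _ do rewrite (exchange_big_dep predT) //=.
rewrite [X in t * X]exchange_big mulr_sumr -big_split /=; apply: eq_bigr => e _.
rewrite (eq_bigr (fun a : 'I_M.+1 => if (a < e)%N then omega a * (cc - 1) * g ^+ (e - a).-1 * f e else 0));
  last first.
  move=> a _; case: ltnP => ae; last by rewrite big_pred0 // => d; lia.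
  rewrite -big_distrl -mulr_sumr /=. rewrite -[X in _ = X * _]mulrA -nu_tail.
  by congr (_ * _ * _); apply: eq_bigl => d; lia.
rewrite -big_mkcond -big_distrl /= mulrA -mulrDl; congr (_ * _).
rewrite -(big_ord_widen M.+1 (fun a => omega a * (cc - 1) * g ^+ (e - a).-1)) ?(ltnW (ltn_ord e)) //.
case: (nat_of_ord e) => {e} [|e]; first by rewrite big_ord0 mulr0 addr0.
(* The inductive step rests on g - (t + t k) = t (cc - 1). *)
suff -> : \sum_(a < e.+1) omega a * (cc - 1) * g ^+ (e.+1 - a).-1 = cc * g ^+ e - (t + t * k) ^+ e.
  by rewrite /=; ring.
elim: e => [|e IH]; first by rewrite big_ord1 /=; ring.
rewrite big_ord_recr /= subSnn /=.
have E (a : 'I_e.+1) : (e.+2 - a).-1 = (e.+1 - a).-1.+1 by have := ltn_ord a; lia.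
under eq_bigr => a _ do rewrite E exprS mulrCA.
by rewrite -mulr_sumr IH !exprS /g; ring.
Qed.

Lemma nu_sum : \sum_(d < M.+1) nu d = cc.
Proof.
rewrite (bigD1 ord0) //= (eq_bigl (fun d : 'I_M.+1 => (0 < d)%N)) => [|d].
  by rewrite nu_tail; ring.
by rewrite -val_eqE /=; lia.
Qed.

End Solve.

End Nilpotent.

(** * Permutations as words *)

Local Notation "s `[ i ]" := (nth 0 s i) (at level 2, format "s `[ i ]").

Definition wf (n : nat) (s : seq nat) := [&& size s == n, uniq s & all (gtn n) s].

(** Inverse to deleting the first entry and standardizing the rest. *)
Definition pre (v : nat) (s : seq nat) := v :: map (bump v) s.
Definition dsum (Z Q : seq nat) := Z ++ map (addn (size Z)) Q.

Definition av321 (s : seq nat) : bool := `[< forall i j k, i < j -> j < k -> k < size s ->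
  s`[k] < s`[j] -> s`[j] < s`[i] -> False >].

Definition av3241_4321 (s : seq nat) : bool :=
  `[< forall i j k l, i < j -> j < k -> k < l -> l < size s ->
      (s`[l] < s`[j] -> s`[j] < s`[i] -> s`[i] < s`[k] -> False) /\
      (s`[l] < s`[k] -> s`[k] < s`[j] -> s`[j] < s`[i] -> False) >].

(* [pre v s] has no occurrence of 3241 or 4321 starting at its first entry; values of [s]
   that are at least [v] are raised by one in [pre v s], hence the weak side of [s`[j] < v]. *)
Definition admissible (s : seq nat) (v : nat) : bool :=
  `[< forall i j k, i < j -> j < k -> k < size s -> s`[k] < s`[i] -> s`[i] < v ->
      s`[j] < v /\ ~ (s`[k] < s`[j] /\ s`[j] < s`[i]) >].

Definition cut (s : seq nat) (k : nat) : bool := all (fun i => s`[i] < k) (iota 0 k).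

Definition indec (s : seq nat) : bool :=
  (0 < size s) && `[< forall k, 0 < k -> k < size s -> ~~ cut s k >].

(* Position [j] becomes blue when a new maximum is put in front of [s]. *)
Definition blue_under (s : seq nat) (j : nat) : bool :=
  `[< (exists k, [/\ j < k, k < size s & s`[k] < s`[j]]) \/
      (exists a b, [/\ a < b, b < j, s`[b] < s`[j] & s`[j] < s`[a]]) >].

Definition blue_at (s : seq nat) (j : nat) : bool :=
  `[< (exists i k, [/\ i < j, j < k, k < size s, s`[k] < s`[j] & s`[j] < s`[i]]) \/
      (exists a b c, [/\ a < b, b < c, c < j & [/\ s`[c] < s`[j], s`[j] < s`[b] & s`[b] < s`[a]]]) >].

(** The point 0 is always a cut and the full length is not tested, so the cuts counted are the
    starting points of the indecomposable components. *)
Definition comps (s : seq nat) := count (cut s) (iota 0 (size s)).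
(* [sites] also counts the height [size s], which is admissible exactly when [s] avoids
   321; [lsites] leaves it out. *)
Definition sites (s : seq nat) := count (admissible s) (iota 1 (size s)).
Definition lsites (s : seq nat) := count (admissible s) (iota 1 (size s).-1).
Definition nblues (s : seq nat) := count (blue_at s) (iota 0 (size s)).

Lemma cutP s k : reflect (forall i, i < k -> s`[i] < k) (cut s k).
Proof.
apply: (iffP allP) => H i; last by rewrite mem_iota => /H.
by move=> ik; apply: H; rewrite mem_iota.
Qed.

Section WF.
Variables (n : nat) (s : seq nat).
Hypothesis ws : wf n s.

Lemma wf_size : size s = n. Proof. by case/and3P: ws => /eqP. Qed.
Lemma wf_lt i : i < n -> s`[i] < n.
Proof. by case/and3P: ws => /eqP <- _ /allP H i_n; apply/H/mem_nth. Qed.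
Lemma wf_inj i j : i < n -> j < n -> s`[i] = s`[j] -> i = j.
Proof. by case/and3P: ws => /eqP <- u _ ? ? /eqP; rewrite nth_uniq // => /eqP. Qed.
Lemma wf_perm : perm_eq s (iota 0 n).
Proof.
case/and3P: ws => /eqP sn u /allP a; apply: uniq_perm => //; first exact: iota_uniq.
have sS : {subset s <= iota 0 n} by move=> x /a; rewrite mem_iota.
by have [] := uniq_min_size u sS; rewrite ?size_iota ?sn.
Qed.
Lemma wf_surj v : v < n -> exists2 i, i < n & s`[i] = v.
Proof.
move=> vn; have : v \in s by rewrite (perm_mem wf_perm) mem_iota.
by case/(nthP 0) => i; rewrite wf_size; exists i.
Qed.
End WF.

Lemma nth_pre v s i : i < size s -> (pre v s)`[i.+1] = bump v s`[i].
Proof. by move=> h; rewrite /= (nth_map 0). Qed.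

Lemma nth_dsum Z Q i : i < size Z + size Q ->
  (dsum Z Q)`[i] = if i < size Z then Z`[i] else size Z + Q`[i - size Z].
Proof. by move=> h; rewrite nth_cat; case: ltnP => // h'; rewrite (nth_map 0) //; lia. Qed.

Lemma size_dsum Z Q : size (dsum Z Q) = size Z + size Q.
Proof. by rewrite size_cat size_map. Qed.

Lemma wf_pre n v s : v <= n -> wf n s -> wf n.+1 (pre v s).
Proof.
move=> vn /and3P[/eqP sn us /allP a]; rewrite /wf /= size_map sn eqxx /=.
rewrite (map_inj_uniq (can_inj (bumpK v))) us ltnS vn andbT /=.
apply/andP; split; first by apply/mapP => -[x _]; rewrite /bump; lia.
by apply/allP => x /mapP[y /a yn ->]; rewrite /= /bump; move: yn; rewrite /=; lia.
Qed.

Lemma wf_preE n s : wf n.+1 s -> exists v s', [/\ v <= n, wf n s' & s = pre v s'].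
Proof.
case/and3P; case: s => [|v s] //=; rewrite eqSS => /eqP sn /andP[vs us] /andP[vn /allP a].
have uK : {in s, cancel (unbump v) (bump v)}.
  by move=> x xs; apply: unbumpK; apply: contraNneq vs => <-.
exists v, (map (unbump v) s); split; first by move: vn.
  rewrite /wf size_map sn eqxx map_inj_in_uniq ?us /=; last exact: can_in_inj uK.
  apply/allP => x /mapP[y ys ->]; have := a _ ys; rewrite /= /unbump.
  have : y != v by apply: contraNneq vs => <-.
  by move: vn; lia.
by rewrite /pre -map_comp; congr (_ :: _); rewrite -[LHS]map_id; apply/esym/eq_in_map => x /uK.
Qed.

Lemma wf_dsum m n Z Q : wf m Z -> wf n Q -> wf (m + n) (dsum Z Q).
Proof.
move=> /and3P[/eqP sZ uZ /allP aZ] /and3P[/eqP sQ uQ /allP aQ].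
rewrite /wf size_dsum sZ sQ eqxx /= cat_uniq uZ (map_inj_uniq (@addnI _)) uQ andbT /=.
rewrite all_cat; apply/and3P; split.
- by apply/hasPn => x /mapP[y _ ->]; apply/negP => /aZ /=; lia.
- by apply/allP => x /aZ /=; lia.
- by apply/allP => x /mapP[y /aQ /= ? ->]; lia.
Qed.

(** An occurrence that uses the new first entry uses it as the 3 of 3241 or the 4 of 4321, which is
    what [admissible] rules out. *)
Lemma cls_pre v s : av3241_4321 (pre v s) = av3241_4321 s && admissible s v.
Proof.
apply/asboolP/andP => [H|[/asboolP H1 /asboolP H2]].
  split; apply/asboolP.
    move=> i j k l ij jk kl ls; have := H i.+1 j.+1 k.+1 l.+1.
    rewrite !nth_pre /bump ?[size _]/= ?size_map; lia.
  move=> i j k ij jk ks; have := H 0 i.+1 j.+1 k.+1.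
  rewrite !nth_pre /bump ?[size _]/= ?size_map ?[nth _ _ 0]/=; lia.
move=> i [|j] // [|k] // [|l] // ij jk kl; rewrite [size _]/= size_map => ls.
rewrite !(@nth_pre v s); try lia.
case: i ij => [|i] ij; last by rewrite nth_pre /bump; have := H1 i j k l; lia.
by have := H2 j k l; rewrite /= /bump; lia.
Qed.

Lemma cut_pre v s k : k <= size s -> cut (pre v s) k.+1 = (v <= k) && cut s k.
Proof.
move=> ks; apply/cutP/andP => [H|[vk /cutP H] [|i] ik]; last 2 first.
- by rewrite /=; lia.
- by rewrite nth_pre /bump; have := H i; lia.
have vk : v <= k by have := H 0; rewrite /=; lia.
by split=> //; apply/cutP => i ik; have := H i.+1; rewrite nth_pre /bump; lia.
Qed.

(** * Direct sums *)

Section DSum.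
Variables (m n : nat) (Z Q : seq nat).
Hypotheses (wZ : wf m Z) (wQ : wf n Q).
Let sZ := wf_size wZ.
Let sQ := wf_size wQ.

Lemma nth_dsuml i : i < m -> (dsum Z Q)`[i] = Z`[i].
Proof. by move=> im; rewrite nth_dsum ?sZ ?sQ ?im //; lia. Qed.

Lemma nth_dsumr i : i < n -> (dsum Z Q)`[m + i] = m + Q`[i].
Proof.
move=> im; rewrite nth_dsum sZ ?sQ; last by lia.
by rewrite ltnNge leq_addr /= addKn.
Qed.

(** Pattern arguments on a direct sum place each index in one summand; mixed placements die
    arithmetically, since [Z] lies before and below [Q]. *)
Lemma dsum_cases i : i < m + n ->
  (i < m /\ (dsum Z Q)`[i] = Z`[i] /\ Z`[i] < m) \/
  (exists i', [/\ i = m + i', i' < n & (dsum Z Q)`[i] = m + Q`[i']]).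
Proof.
case: (ltnP i m) => im h; [left|right].
  by split=> //; rewrite nth_dsuml //; split=> //; apply: wf_lt.
by exists (i - m); split; [lia|lia|rewrite -{1}(subnKC im) nth_dsumr //; lia].
Qed.

Lemma av321_dsum : av321 (dsum Z Q) = av321 Z && av321 Q.
Proof.
apply/asboolP/andP => [H|[/asboolP H1 /asboolP H2]].
  split; apply/asboolP => i j k ij jk; rewrite ?sZ ?sQ => ks.
    by have := H i j k; rewrite size_dsum sZ sQ !nth_dsuml; lia.
  by have := H (m + i) (m + j) (m + k); rewrite size_dsum sZ sQ !nth_dsumr; lia.
move=> i j k ij jk; rewrite size_dsum sZ sQ => ks.
have hi : i < m + n by lia.
have hj : j < m + n by lia.
have hk : k < m + n by lia.
case: (dsum_cases hi) => [[Hi [-> Hi']]|[i' [Ei Hi ->]]];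
case: (dsum_cases hj) => [[Hj [-> Hj']]|[j' [Ej Hj ->]]]; try lia;
case: (dsum_cases hk) => [[Hk [-> Hk']]|[k' [Ek Hk ->]]]; try lia.
  by have := H1 i j k; lia.
by have := H2 i' j' k'; lia.
Qed.

Lemma cls_dsum : av3241_4321 (dsum Z Q) = av3241_4321 Z && av3241_4321 Q.
Proof.
apply/asboolP/andP => [H|[/asboolP H1 /asboolP H2]].
  split; apply/asboolP => i j k l ij jk kl; rewrite ?sZ ?sQ => ks.
    by have := H i j k l; rewrite size_dsum sZ sQ !nth_dsuml; lia.
  by have := H (m + i) (m + j) (m + k) (m + l); rewrite size_dsum sZ sQ !nth_dsumr; lia.
move=> i j k l ij jk kl; rewrite size_dsum sZ sQ => ks.
have hi : i < m + n by lia.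
have hj : j < m + n by lia.
have hk : k < m + n by lia.
have hl : l < m + n by lia.
case: (dsum_cases hi) => [[Hi [-> Hi']]|[i' [Ei Hi ->]]];
case: (dsum_cases hj) => [[Hj [-> Hj']]|[j' [Ej Hj ->]]]; try lia;
case: (dsum_cases hk) => [[Hk [-> Hk']]|[k' [Ek Hk ->]]]; try lia;
case: (dsum_cases hl) => [[Hl [-> Hl']]|[l' [El Hl ->]]]; try lia.
  by have := H1 i j k l; lia.
by have := H2 i' j' k' l'; lia.
Qed.

(** An inversion whose top is below [u <= m] lies in [Z], and so does every position between its
    ends. *)
Lemma admissible_dsuml u : u <= m -> admissible (dsum Z Q) u = admissible Z u.
Proof.
move=> um; apply/asboolP/asboolP => H i j k ij jk; rewrite ?size_dsum ?sZ ?sQ => ks.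
  by have := H i j k; rewrite size_dsum sZ sQ !nth_dsuml; lia.
have hi : i < m + n by lia.
have hj : j < m + n by lia.
have hk : k < m + n by lia.
case: (dsum_cases hi) => [[Hi [-> Hi']]|[i' [Ei Hi ->]]];
case: (dsum_cases hj) => [[Hj [-> Hj']]|[j' [Ej Hj ->]]]; try lia;
case: (dsum_cases hk) => [[Hk [-> Hk']]|[k' [Ek Hk ->]]]; try lia.
by have := H i j k; lia.
Qed.

(** A height above [m] exceeds all of [Z], so any 321 in [Z] would become a 4321; inversions of [Q]
    are tested at height [u]. *)
Lemma admissible_dsumr u : 0 < u -> admissible (dsum Z Q) (m + u) = av321 Z && admissible Q u.
Proof.
move=> u0; apply/asboolP/andP => [H|[/asboolP H1 /asboolP H2]].
  split; apply/asboolP => i j k ij jk; rewrite ?sZ ?sQ => ks.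
    have := H i j k; have := @wf_lt _ _ wZ i.
    by rewrite size_dsum sZ sQ !nth_dsuml; lia.
  by have := H (m + i) (m + j) (m + k); rewrite size_dsum sZ sQ !nth_dsumr; lia.
move=> i j k ij jk; rewrite size_dsum sZ sQ => ks.
have hi : i < m + n by lia.
have hj : j < m + n by lia.
have hk : k < m + n by lia.
case: (dsum_cases hi) => [[Hi [-> Hi']]|[i' [Ei Hi ->]]];
case: (dsum_cases hj) => [[Hj [-> Hj']]|[j' [Ej Hj ->]]]; try lia;
case: (dsum_cases hk) => [[Hk [-> Hk']]|[k' [Ek Hk ->]]]; try lia.
  by have := H1 i j k; lia.
by have := H2 i' j' k'; lia.
Qed.

Lemma cut_dsuml k : k <= m -> cut (dsum Z Q) k = cut Z k.
Proof.
move=> km; apply/cutP/cutP => H i ik; have := H i ik; rewrite nth_dsuml //; lia.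
Qed.

Lemma cut_dsumr k : k <= n -> cut (dsum Z Q) (m + k) = cut Q k.
Proof.
move=> kn; apply/cutP/cutP => H i ik.
  by have := H (m + i); rewrite nth_dsumr; lia.
have hi : i < m + n by lia.
by case: (dsum_cases hi) => [[? [-> ?]]|[i' [? ? ->]]]; [lia|have := H i'; lia].
Qed.

Lemma comps_dsum : comps (dsum Z Q) = comps Z + comps Q.
Proof.
rewrite /comps size_dsum sZ sQ iotaD count_cat; congr (_ + _).
  by apply: eq_in_count => k; rewrite mem_iota => ?; apply: cut_dsuml; lia.
rewrite addnC iotaDl count_map; apply: eq_in_count => k; rewrite mem_iota => ? /=.
by rewrite cut_dsumr //; lia.
Qed.

Lemma count_admissible_dsum u : av321 Z ->
  count (admissible (dsum Z Q)) (iota 1 (m + u)) = sites Z + count (admissible Q) (iota 1 u).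
Proof.
move=> aZ; rewrite /sites sZ iotaD count_cat; congr (_ + _).
  by apply: eq_in_count => k; rewrite mem_iota => ?; apply: admissible_dsuml; lia.
rewrite addnC iotaDl count_map; apply: eq_in_count => k; rewrite mem_iota => ? /=.
by rewrite admissible_dsumr ?aZ //; lia.
Qed.

End DSum.

(** * Admissible heights of indecomposable words *)

Lemma indec_ncut s k : indec s -> 0 < k -> k < size s -> exists2 i, i < k & k <= s`[i].
Proof.
move=> /andP[_ /asboolP H] k0 ks; have /allPn[i] := H k k0 ks.
by rewrite mem_iota -leqNgt => /= ik h; exists i.
Qed.

(* Otherwise let [j] be the first position with a value at least [u]; as [s] does not split
   at [j], some inversion straddles [j], and it makes a 3241 with [u] and [s`[j]]. *)
Lemma admissible_indec_head n s u : wf n s -> indec s -> 0 < u -> u < n -> admissible s u -> u <= s`[0].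
Proof.
move=> ws inds u0 un /asboolP oku; rewrite leqNgt; apply/negP => s0u.
have sn := wf_size ws.
have [i0 i0n Ei0] := wf_surj ws un.
have ex : exists j, (j < n) && (u <= s`[j]) by exists i0; rewrite i0n Ei0 leqnn.
case: (ex_minnP ex) => j /andP[jn uj] jmin.
have j0 : 0 < j by case: j uj {jn jmin} => //; lia.
have [i ij ji] := indec_ncut inds j0 (eq_ind_r (fun x => j < x) jn sn).
have siu : s`[i] < u by rewrite ltnNge; apply/negP => h; have := jmin i; rewrite h; lia.
(* Pigeonhole: at least [j.+1] values do not exceed the entry at [i], so one of them, [y], is
   missing from the first [j] positions. *)
have /allPn[y] : ~~ all (fun x => x \in take j s) (iota 0 s`[i].+1).
  apply/negP => /allP sS; have := uniq_leq_size (iota_uniq 0 s`[i].+1) sS.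
  by rewrite size_iota size_takel ?sn; lia.
rewrite mem_iota => /= yi ynot.
have yn : y < n by lia.
have [k kn Ek] := wf_surj ws yn.
have jk : j <= k.
  rewrite leqNgt; apply/negP => kj; case/negP: ynot; rewrite -Ek -(nth_take 0 kj).
  by rewrite mem_nth // size_takel // sn; lia.
have yi' : y != s`[i].
  apply: contraNneq ynot => ->; rewrite -(nth_take 0 ij).
  by rewrite mem_nth // size_takel // sn; lia.
have jk' : j != k by apply/eqP => jk'; move: uj; rewrite jk' Ek; lia.
have := oku i j k ij; rewrite sn Ek; lia.
Qed.

(** For heights up to [v], raising values does not change which entries lie below, and the first
    entry, not being below, tops no inversion to test. Larger heights are excluded by
    [admissible_indec_head]. *)
Lemma lsites_pre n v s : wf n s -> v <= n -> indec (pre v s) ->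
  lsites (pre v s) = count (admissible s) (iota 1 v).
Proof.
move=> ws vn ind; have sn := wf_size ws; have wp := wf_pre vn ws.
rewrite /lsites (wf_size wp) /= -{1}(subnKC vn) iotaD count_cat.
rewrite [X in _ + X](eq_in_count (a2 := pred0)) ?count_pred0 ?addn0.
  apply: eq_in_count => u; rewrite mem_iota => uv.
  apply/asboolP/asboolP => H i j k ij jk ks.
    have := H i.+1 j.+1 k.+1; rewrite !nth_pre /bump ?[size _]/= ?size_map; lia.
  case: j k ij jk ks => [|j] // [|k] // ij jk; rewrite [size _]/= size_map => ks.
  case: i ij => [|i] ij; first by rewrite /=; lia.
  by rewrite !nth_pre /bump; have := H i j k; lia.
move=> u; rewrite mem_iota => uv; apply/negP => oku.
have := admissible_indec_head wp ind _ _ oku; rewrite /=; lia.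
Qed.

Lemma admissible_full n s : wf n s -> admissible s n = av321 s.
Proof.
move=> ws; have sn := wf_size ws; apply/asboolP/asboolP => H i j k ij jk ks.
  by have := H i j k; have := wf_lt ws (_ : i < n); lia.
have := H i j k; have := wf_lt ws (_ : j < n); lia.
Qed.

Lemma av321_cls s : av321 s -> av3241_4321 s.
Proof.
move=> /asboolP H; apply/asboolP => i j k l ij jk kl ls.
by have := H i j l; have := H j k l; lia.
Qed.

Lemma cls_pre_full n s : wf n s -> av3241_4321 (pre n s) = av321 s.
Proof.
move=> ws; rewrite cls_pre (admissible_full ws) andb_idl //; exact: av321_cls.
Qed.

Lemma sites_av321 n s : wf n.+1 s -> av321 s -> sites s = (lsites s).+1.
Proof.
move=> ws a; have E : iota 1 n.+1 = iota 1 n ++ [:: n.+1] by rewrite -(iotaD 1 n 1) addn1.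
by rewrite /sites /lsites (wf_size ws) E count_cat [X in _ + X]/= (admissible_full ws) a addn0 addn1.
Qed.

(** * Blue entries after adding a first entry *)

Lemma blue_at_pre v s j : j < size s -> blue_at (pre v s) j.+1 <->
  [\/ blue_at s j,
      s`[j] < v /\ (exists k, [/\ j < k, k < size s & s`[k] < s`[j]]) |
      exists a b, [/\ a < b, b < j, s`[b] < s`[j], s`[j] < s`[a] & s`[a] < v]].
Proof.
move=> js; split.
  (* The new entry can only take a leading role: index 0 is the 3 of a 321 or the 4 of a 4312.
     Otherwise all indices shift down to [s]. *)
  case/asboolP.
    case=> [[|i]] [[|k]] [//= ij jk]; rewrite size_map => ks; rewrite !(nth_map 0) //; try lia.
      by move=> h1 h2; apply: Or32; split; [|exists k; split]; move: h1 h2; rewrite /bump; lia.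
    move=> h1 h2; apply: Or31; apply/asboolP; left; exists i, k; move: h1 h2.
    by rewrite /bump; split; lia.
  case=> [[|a]] [[|b]] [[|c]] [//= ab bc cj [h1 h2 h3]].
    apply: Or33; exists b, c; move: h1 h2 h3; rewrite !(nth_map 0) /bump; try lia.
    by split; lia.
  apply: Or31; apply/asboolP; right; exists a, b, c; move: h1 h2 h3.
  by rewrite !(nth_map 0) /bump; try lia; do 2?split; lia.
case=> [/asboolP[[i [k [ij jk ks h1 h2]]]|[a [b [c [ab bc cj [h1 h2 h3]]]]]]
  |[jv [k [jk ks h]]]|[a [b [ab bj h1 h2 h3]]]]; apply/asboolP.
- left; exists i.+1, k.+1; rewrite !nth_pre ?[size _]/= ?size_map /bump; try lia.
  by split; lia.
- right; exists a.+1, b.+1, c.+1; rewrite !nth_pre /bump; try lia.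
  by do 2?split; lia.
- left; exists 0, k.+1; rewrite !nth_pre ?[size _]/= ?size_map ?[nth _ _ 0]/= /bump; try lia.
  by split; lia.
- right; exists 0, a.+1, b.+1; rewrite !nth_pre ?[nth _ _ 0]/= /bump; try lia.
  by do 2?split; lia.
Qed.

Lemma nblues_pre v s : nblues (pre v s) = count (fun j => blue_at (pre v s) j.+1) (iota 0 (size s)).
Proof.
rewrite /nblues [size _]/= size_map [iota _ _]/= -[1]addn0 iotaDl /= count_map.
rewrite (_ : blue_at _ 0 = false) //; apply/negP => /asboolP[[i [k []]]|[a [b [c []]]]] //.
Qed.

Lemma blue_at_under s j : blue_at s j -> blue_under s j.
Proof.
case/asboolP=> [[i [k [? ? ? ? ?]]]|[a [b [c [? ? ? [? ? ?]]]]]]; apply/asboolP.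
  by left; exists k.
by right; exists b, c.
Qed.

(** A cut at c starts a component whose minimum is the value c, so the white entries are the
    component minima. *)
Lemma white_under_cut n s j : wf n s -> j < n -> ~~ blue_under s j = cut s s`[j].
Proof.
move=> ws jn; have sn := wf_size ws; apply/idP/idP => [/asboolPn H|/cutP H].
  have bef z : z < n -> s`[z] < s`[j] -> z < j.
    move=> zn zj; rewrite ltnNge; apply/negP => jz; apply: H; left; exists z.
    by rewrite sn; split=> //; have : z != j by [apply: contraTneq zj => ->; lia]; lia.
  apply/cutP => i ij; rewrite ltnNge; apply/negP => ji.
  have i_n : i < n by have := wf_lt ws jn; lia.
  (* Pigeonhole: the first [i] positions cannot hold all values below the entry at [j]. One of these
     is at some [k] between [i] and [j], and [i], [k], [j] form a 312. *)
  have /allPn[y] : ~~ all (fun x => x \in take i s) (iota 0 s`[j]).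
    apply/negP => /allP sS; have := uniq_leq_size (iota_uniq 0 s`[j]) sS.
    by rewrite size_iota size_takel ?sn; lia.
  rewrite mem_iota => /= yj ynot.
  have yn : y < n by have := wf_lt ws jn; lia.
  have [k kn Ek] := wf_surj ws yn.
  have ik : i <= k.
    rewrite leqNgt; apply/negP => ki; case/negP: ynot; rewrite -Ek -(nth_take 0 ki).
    by rewrite mem_nth // size_takel // sn; lia.
  have kj : k < j by apply: bef => //; rewrite Ek.
  have ik' : i != k by apply/eqP => ik'; move: ji; rewrite ik' Ek; lia.
  apply: H; right; exists i, k; rewrite Ek; split=> //; first by lia.
  rewrite ltn_neqAle ji andbT; apply/eqP => E; have := wf_inj ws jn i_n E; lia.
apply/asboolPn; have jj : s`[j] <= j.
  by rewrite leqNgt; apply/negP => /H; lia.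
(* The positions before the cut already use up all the smaller values; a further one would make one
   too many. *)
have cutlt z : z < n -> s`[z] < s`[j] -> z < s`[j].
  move=> zn zj; rewrite ltnNge; apply/negP => jz.
  have sS : {subset take s`[j] s ++ [:: s`[z]] <= iota 0 s`[j]}.
    move=> x; rewrite mem_cat inE => /orP[/(nthP 0)[i]|/eqP ->]; last by rewrite mem_iota.
    rewrite size_takel ?sn; last by have := wf_lt ws jn; lia.
    by move=> ij; rewrite nth_take // => <-; rewrite mem_iota; apply: H.
  have : uniq (take s`[j] s ++ [:: s`[z]]).
    have /and3P[_ us _] := ws; rewrite cat_uniq take_uniq //= orbF andbT.
    apply/negP => /(nthP 0)[i]; rewrite size_takel ?sn; last by have := wf_lt ws jn; lia.
    move=> ij; rewrite nth_take // => E.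
    by have := wf_inj ws _ zn E; have := wf_lt ws jn; lia.
  move=> /uniq_leq_size /(_ sS); rewrite size_cat size_iota size_takel ?sn /=; first by lia.
  by have := wf_lt ws jn; lia.
case=> [[k [jk]]|[a [b [ab bj]]]].
  by rewrite sn => kn h; have := cutlt k kn h; lia.
move=> h1 h2; have bn : b < n by lia.
have := cutlt b bn h1 => h3; have := H a; lia.
Qed.

(* The positions that stay white carry the minima of the components. *)
Lemma count_blue_under n s : wf n s -> count (blue_under s) (iota 0 n) = n - comps s.
Proof.
move=> ws; have sn := wf_size ws.
have <- : count (predC (blue_under s)) (iota 0 n) = comps s.
  rewrite (eq_in_count (a2 := preim (nth 0 s) (cut s))) => [|j].
    rewrite -count_map -{1}sn map_nth_iota0 // take_size.
    by rewrite /comps sn; apply/seq.permP/(wf_perm ws).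
  by rewrite mem_iota => /= jn; rewrite (white_under_cut ws jn).
by have := count_predC (blue_under s) (iota 0 n); rewrite size_iota; lia.
Qed.

(** A leading maximum can serve as the 3 or the 4 for every entry, and an entry already blue in [s]
    is also blue under it. *)
Lemma nblues_pre_full n s : wf n s -> nblues (pre n s) = n - comps s.
Proof.
move=> ws; have sn := wf_size ws; rewrite nblues_pre sn -(count_blue_under ws).
apply: eq_in_count => j; rewrite mem_iota => /= jn.
have js : j < size s by rewrite sn.
apply/idP/asboolP; rewrite (blue_at_pre _ js).
  case=> [/blue_at_under/asboolP//|[_ H]|[a [b [? ? ? ? ?]]]]; [by left|by right; exists a, b].
have jn' := wf_lt ws jn.
case=> H; [by apply: Or32|apply: Or33].
case: H => [a [b [? ? ? ?]]]; exists a, b; split=> //.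
by apply: (wf_lt ws); lia.
Qed.

(** The first three entries of a 4312 form a 321, so any blue entry forces a 321. *)
Lemma nblues_eq0 s : (nblues s == 0) = av321 s.
Proof.
rewrite /nblues -leqn0 leqNgt -has_count; apply/hasPn/asboolP => H.
  move=> i j k ij jk ks h1 h2; have js : j \in iota 0 (size s) by rewrite mem_iota; lia.
  have /negP := H j js; apply.
  by apply/asboolP; left; exists i, k.
move=> j; rewrite mem_iota => /= js; apply/negP => /asboolP[[i [k [? ? ? ? ?]]]|].
  exact: (H i j k).
by case=> [a [b [c [? ? ? [? ? ?]]]]]; apply: (H a b c) => //; lia.
Qed.

(** Over [Z] the first entry acts as a maximum. Over [Q] it creates no new blue entry: [Q] starts at
    height at least [u], so its own first entry can take over the role of 3 or 4. *)
Lemma nblues_pre_dsum m n Z Q u : wf m Z -> wf n Q -> av321 Z -> indec Q ->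
  0 < u -> u < n -> admissible Q u ->
  nblues (pre (m + u) (dsum Z Q)) = m - comps Z + nblues Q.
Proof.
move=> wZ wQ aZ iQ u0 un okQ; have sZ := wf_size wZ; have sQ := wf_size wQ.
have uQ := admissible_indec_head wQ iQ u0 un okQ.
rewrite nblues_pre size_dsum sZ sQ iotaD count_cat add0n -[X in iota X n]addn0 iotaDl count_map.
congr (_ + _).
  rewrite -(count_blue_under wZ); apply: eq_in_count => j; rewrite mem_iota => /= jm.
  have jZ := wf_lt wZ jm.
  apply/idP/asboolP; rewrite blue_at_pre ?size_dsum ?sZ ?sQ; try lia; rewrite ?(nth_dsuml wZ wQ) //.
    case=> [/asboolP[[i [k []]]|[a [b [c []]]]]|[_ [k []]]|[a [b []]]]; rewrite ?size_dsum ?sZ ?sQ.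
    - move=> ij jk ks; have ? : i < m by lia.
      rewrite (nth_dsuml wZ wQ jm).
      case: (dsum_cases wZ wQ ks) => [[? [-> ?]]|[k' [? ? ->]]]; last by lia.
      by move=> ? ?; left; exists k; split=> //; lia.
    - move=> ab bc cj [h1 h2 h3]; right; exists b, c; move: h1 h2 h3.
      by rewrite !(nth_dsuml wZ wQ); try lia; split; lia.
    - move=> jk ks; case: (dsum_cases wZ wQ ks) => [[? [-> ?]]|[k' [? ? ->]]]; last by lia.
      by move=> ?; left; exists k; split=> //; lia.
    - move=> ab bj h1 h2 _; right; exists a, b; move: h1 h2.
      by rewrite !(nth_dsuml wZ wQ); try lia; split; lia.
  case=> [[k [jk km h]]|[a [b [ab bj h1 h2]]]].
    apply: Or32; split; first by lia.
    by exists k; rewrite (nth_dsuml wZ wQ) //; split=> //; lia.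
  apply: Or33; exists a, b; rewrite !(nth_dsuml wZ wQ); try lia.
  by have := wf_lt wZ (_ : a < m); split; lia.
rewrite /nblues sQ; apply: eq_in_count => j; rewrite mem_iota => /= jn.
have lift i : i < n -> (dsum Z Q)`[m + i] = m + Q`[i] by exact: nth_dsumr.
apply/idP/asboolP; rewrite blue_at_pre ?size_dsum ?sZ ?sQ; try lia; rewrite ?lift //.
  have hi i : i < m + n -> m + Q`[j] < (dsum Z Q)`[i] ->
      exists i', [/\ i = m + i', i' < n & (dsum Z Q)`[i] = m + Q`[i']].
    by move=> h; case: (dsum_cases wZ wQ h) => // -[? [-> ?]]; lia.
  have n0 : 0 < n by lia.
  case=> [/asboolP[[i [k []]]|[a [b [c []]]]]|[h0 [k []]]|[a [b []]]]; rewrite ?size_dsum ?sZ ?sQ.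
  - move=> ij jk ks h1 h2; have ii : i < m + n by lia.
    move: h1; rewrite lift // => h1.
    have [i' [Ei i'n Ei']] := hi i ii (eq_ind _ (fun x => x < _) h2 _ (lift j jn)).
    left; exists i', (k - m); move: h1 h2; rewrite Ei' lift // (_ : k = m + (k - m)); last by lia.
    by rewrite lift ?addKn; try lia; split; lia.
  - move=> ab bc cj [h1 h2 h3]; have aa : a < m + n by lia.
    have bb : b < m + n by lia.
    rewrite lift // in h1 h2.
    have [b' [Eb b'n Eb']] := hi b bb h2.
    have [a' [Ea a'n Ea']] := hi a aa (ltn_trans h2 h3).
    right; exists a', b', (c - m); move: h1 h2 h3; rewrite Eb' Ea' (_ : c = m + (c - m)); last by lia.
    by rewrite lift ?addKn; try lia; do 2?split; lia.
  - move=> jk ks; rewrite (_ : k = m + (k - m)); last by lia.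
    rewrite !lift; try lia.
    have j0 : j != 0 by apply/eqP => j0; move: h0; rewrite j0; lia.
    by move=> h; left; exists 0, (k - m); split; lia.
  - move=> ab bj h1 h2 h3; have aa : a < m + n by lia.
    have [a' [Ea a'n Ea']] := hi a aa h2.
    move: h1 h2 h3; rewrite Ea' (_ : b = m + (b - m)); last by lia.
    rewrite !lift; try lia.
    move=> h1 h2 h3; have a0 : a' != 0 by apply/eqP => a0; move: h3; rewrite a0; lia.
    right; exists 0, a', (b - m); do 2?split; lia.
case=> [[i [k [? ? ? ? ?]]]|[a [b [c [? ? ? [? ? ?]]]]]]; apply: Or31; apply/asboolP.
  left; exists (m + i), (m + k); rewrite size_dsum sZ sQ !lift; try lia.
  by split; lia.
right; exists (m + a), (m + b), (m + c); rewrite !lift; try lia.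
by do 2?split; lia.
Qed.

(** * Enumeration and the recurrences *)

Fixpoint perms (n : nat) : seq (seq nat) :=
  if n is n'.+1 then [seq pre v s | s <- perms n', v <- iota 0 n'.+1] else [:: [::]].

Lemma mem_perms n s : (s \in perms n) = wf n s.
Proof.
elim: n s => [|n IH] s; first by rewrite inE /wf; case: s.
apply/allpairsP/idP => [[[s' v] []]|].
  by rewrite IH mem_iota /= => ws vn ->; apply: wf_pre.
case/wf_preE=> v [s' [vn ws ->]]; exists (s', v); split=> //; first by rewrite IH.
by rewrite mem_iota.
Qed.

Lemma pre_inj v v' s s' : pre v s = pre v' s' -> v = v' /\ s = s'.
Proof. by case=> -> /(inj_map (can_inj (bumpK v'))). Qed.

Lemma perms_uniq n : uniq (perms n).
Proof.
elim: n => // n IH; apply: allpairs_uniq => //; first exact: iota_uniq.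
by move=> [s v] [s' v'] _ _ /= /pre_inj[-> ->].
Qed.

(** * Splitting off the last component *)

Definition lastcut (s : seq nat) := \max_(k < size s | cut s k) k.

Lemma cut0 s : cut s 0. Proof. by []. Qed.

Lemma lastcutP s : 0 < size s -> cut s (lastcut s) /\ lastcut s < size s.
Proof.
move=> s0; have : 0 < #|[pred k : 'I_(size s) | cut s k]|.
  by apply/card_gt0P; exists (Ordinal s0).
by case/(eq_bigmax_cond (fun k : 'I_(size s) => k : nat)) => k kc; rewrite /lastcut => ->.
Qed.

Lemma cut_lastcut s k : k < size s -> cut s k -> k <= lastcut s.
Proof.
by move=> ks kc; apply: (@leq_bigmax_cond _ _ (fun k : 'I_(size s) => k : nat) (Ordinal ks)).
Qed.

Lemma indecP s : reflect (0 < size s /\ forall k, 0 < k -> k < size s -> cut s k -> False) (indec s).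
Proof.
apply: (iffP andP) => -[s0 H]; split=> //.
  by move=> k k0 ks; move/asboolP/(_ k k0 ks)/negP: H.
by apply/asboolP => k k0 ks; apply/negP/H.
Qed.

Lemma cut_dsum m n Z Q : wf m Z -> wf n Q -> cut (dsum Z Q) m.
Proof. by move=> wZ wQ; have := cut_dsumr wZ wQ (leq0n n); rewrite addn0 cut0 => ->. Qed.

Lemma lastcut_dsum m n Z Q : wf m Z -> wf n Q -> indec Q -> lastcut (dsum Z Q) = m.
Proof.
move=> wZ wQ /indecP[]; rewrite (wf_size wQ) => n0 H.
have sD : size (dsum Z Q) = m + n by rewrite size_dsum (wf_size wZ) (wf_size wQ).
have [] := @lastcutP (dsum Z Q); rewrite sD; first by lia.
have : m <= lastcut (dsum Z Q).
  by apply: cut_lastcut; rewrite ?sD ?(cut_dsum wZ wQ) //; lia.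
move=> h c lt; apply/eqP; rewrite eqn_leq h andbT leqNgt; apply/negP => h'.
apply: (H (lastcut (dsum Z Q) - m)); try lia.
by rewrite -(cut_dsumr wZ wQ) ?subnKC //; lia.
Qed.

Lemma dsum_lastcut N s : 0 < N -> wf N s -> exists Z Q,
  [/\ wf (lastcut s) Z, wf (N - lastcut s) Q, indec Q & s = dsum Z Q].
Proof.
move=> N0 ws; have sN := wf_size ws; have /and3P[_ us _] := ws.
have [] := @lastcutP s; rewrite sN //; set m := lastcut s => cm mN.
have wZ : wf m (take m s).
  rewrite /wf size_takel ?sN ?(ltnW mN) // eqxx take_uniq //=.
  apply/(all_nthP 0) => i; rewrite size_takel ?sN ?(ltnW mN) // => im.
  by rewrite nth_take //; move/cutP: cm; apply.
(* The prefix holds all values below [m], so lowering the rest by [m] loses nothing. *)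
have ge x : x \in drop m s -> m <= x.
  move=> xd; rewrite leqNgt; apply/negP => xm.
  have xt : x \in take m s by rewrite (perm_mem (wf_perm wZ)) mem_iota.
  move: us; rewrite -(cat_take_drop m s) cat_uniq => /and3P[_ /hasPn h _].
  by move: (h x xd); rewrite /= xt.
pose Q := map (subn^~ m) (drop m s).
have EQ : map (addn m) Q = drop m s.
  rewrite /Q -map_comp -[RHS]map_id; apply/eq_in_map => x /ge h /=; lia.
have wQ : wf (N - m) Q.
  rewrite /wf size_map size_drop sN eqxx -(map_inj_uniq (@addnI m)) EQ drop_uniq //=.
  apply/allP => x /mapP[y yd ->]; have := mem_drop yd.
  by rewrite (perm_mem (wf_perm ws)) mem_iota /=; have := ge y yd; lia.
have Es : s = dsum (take m s) Q by rewrite /dsum size_takel ?sN ?(ltnW mN) // EQ cat_take_drop.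
exists (take m s), Q; split=> //; apply/indecP; rewrite (wf_size wQ); split; first by lia.
move=> k k0 kn; rewrite -(cut_dsumr wZ wQ) -?Es; last by lia.
by move/cut_lastcut; rewrite sN -/m; lia.
Qed.

Lemma dsum_inj m Z Q Z' Q' : wf m Z -> wf m Z' -> dsum Z Q = dsum Z' Q' -> Z = Z' /\ Q = Q'.
Proof.
move=> /wf_size sZ /wf_size sZ' /eqP; rewrite /dsum eqseq_cat ?sZ ?sZ' // => /andP[/eqP -> /eqP].
by move/(inj_map (@addnI m)).
Qed.

(** * Recurrences for sums over words *)

Section Sums.
Variable R : comNzRingType.
Local Open Scope ring_scope.

Lemma sum_perms_dsum N (F : seq nat -> R) : (0 < N)%N ->
  \sum_(s <- perms N) F s =
  \sum_(m < N) \sum_(Z <- perms m) \sum_(Q <- perms (N - m) | indec Q) F (dsum Z Q).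
Proof.
move=> N0; have part : \sum_(s <- perms N) F s =
    \sum_(m < N) \sum_(s <- perms N | lastcut s == m) F s.
  rewrite (exchange_big_dep predT) //= big_seq_cond [RHS]big_seq_cond.
  apply: eq_bigr => s; rewrite andbT mem_perms => ws.
  have [] := @lastcutP s; rewrite (wf_size ws) // => _ h.
  by rewrite (big_pred1 (Ordinal h)) // => m; rewrite /= eq_sym -val_eqE.
rewrite part; apply: eq_bigr => m _.
transitivity (\sum_(s <- [seq dsum Z Q | Z <- perms m, Q <- filter indec (perms (N - m))]) F s).
  rewrite -big_filter; apply: perm_big; apply: uniq_perm.
  - by rewrite filter_uniq ?perms_uniq.
  - apply: allpairs_uniq; rewrite ?filter_uniq ?perms_uniq //.
    move=> [Z Q] [Z' Q'] /allpairsP[[? ?] [/= h1 _ [-> _]]] /allpairsP[[? ?] [/= h2 _ [-> _]]].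
    rewrite !mem_perms in h1 h2.
    by move=> /(dsum_inj h1 h2)[-> ->].
  move=> s; rewrite mem_filter mem_perms; apply/andP/allpairsP.
    move=> [/eqP Em ws]; have [Z [Q]] := dsum_lastcut N0 ws.
    rewrite Em => -[wZ wQ iQ ->]; exists (Z, Q).
    by split; rewrite /= ?mem_filter ?mem_perms ?iQ.
  move=> [[Z Q] [/=]]; rewrite mem_filter !mem_perms => wZ /andP[iQ wQ] ->.
  rewrite (lastcut_dsum wZ wQ) // eqxx; split=> //.
  by rewrite -{1}(subnKC (ltnW (ltn_ord m))); apply: wf_dsum.
rewrite big_allpairs_dep; apply: eq_bigr => Z _.
by rewrite big_filter.
Qed.

Lemma sum_perms_pre N (P : pred (seq nat)) (F : seq nat -> R) :
  \sum_(X <- perms N.+1 | P X) F X =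
  \sum_(s <- perms N) \sum_(v < N.+1 | P (pre v s)) F (pre v s).
Proof.
rewrite big_mkcond -[perms N.+1]/[seq pre v s | s <- perms N, v <- iota 0 N.+1].
rewrite big_allpairs_dep; apply: eq_bigr => s _.
by rewrite -[iota 0 N.+1]/(index_iota 0 N.+1) big_mkord -big_mkcond.
Qed.

(** For [u] satisfying [P], [count P (iota 1 u)] is the rank of [u] among such points, so the
    summands run once through the ranks from 1. *)
Lemma sum_rank (P : pred nat) (psi : nat -> R) n :
  \sum_(u < n | (0 < u)%N && P u) psi (count P (iota 1 u)) =
  \sum_(x < count P (iota 1 n.-1)) psi x.+1.
Proof.
elim: n => [|n IH]; first by rewrite !big_ord0.
rewrite big_mkcond big_ord_recr -big_mkcond IH /=.
case: n {IH} => [|n]; first by rewrite !big_ord0 addr0.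
have E : iota 1 n.+1 = iota 1 n ++ [:: n.+1] by rewrite -(iotaD 1 n 1) addn1.
rewrite [n.+1.-1]/= E count_cat /=.
by case: (P n.+1) => /=; rewrite ?addr0 ?addn0 // addn1 big_ord_recr.
Qed.

Lemma indec_pre_full N s : wf N s -> indec (pre N s).
Proof.
move=> ws; apply/indecP; rewrite (wf_size (wf_pre (leqnn N) ws)); split=> // -[//|k] _ kN.
rewrite cut_pre ?(wf_size ws); last by lia.
by move=> /andP[]; lia.
Qed.

(** A first entry above [m] destroys every cut up to [m], and [Q] supplies none beyond; a smaller
    one leaves the cut at [m]. *)
Lemma indec_pre_dsum m n v Z Q : wf m Z -> wf n Q -> indec Q -> (v <= m + n)%N ->
  indec (pre v (dsum Z Q)) = (m < v)%N.
Proof.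
move=> wZ wQ /indecP[]; rewrite (wf_size wQ) => n0 H vmn.
have wD := wf_dsum wZ wQ; have sD := wf_size wD.
apply/indecP/idP; rewrite (wf_size (wf_pre vmn wD)).
  move=> [_ H']; rewrite ltnNge; apply/negP => vm.
  apply: (H' m.+1) => //; first by lia.
  by rewrite cut_pre ?sD ?vm ?(cut_dsum wZ wQ) //; lia.
move=> mv; split=> // -[//|k] _ kmn; rewrite cut_pre ?sD; last by lia.
case/andP=> vk; rewrite -(@subnKC m k); last by lia.
by rewrite (cut_dsumr wZ wQ); last lia; apply: H; lia.
Qed.

Lemma comps_indec s : indec s -> comps s = 1%N.
Proof.
case/indecP; rewrite /comps; case: (size s) => // n _ H /=.
rewrite (eq_in_count (a2 := pred0)) ?count_pred0 // => k; rewrite mem_iota => h.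
by apply/negP/H; lia.
Qed.

Lemma comps_le n s : wf n s -> (comps s <= n)%N.
Proof. by move=> ws; rewrite /comps (wf_size ws) (leq_trans (count_size _ _)) // size_iota. Qed.

(** In the first sum the first entry is the maximum. In the second the rest is the direct sum of [Z]
    and its last component [Q], the first entry is some [m + u], and [x.+1] is the rank of [u] among
    the admissible heights of [Q]. *)
Lemma sum_class_rec N (phi : nat -> nat -> R) :
  \sum_(X <- perms N.+1 | indec X && av3241_4321 X) phi (nblues X) (lsites X) =
  \sum_(s <- perms N | av321 s) phi (N - comps s)%N (sites s) +
  \sum_(m < N) \sum_(Z <- perms m | av321 Z)
    \sum_(Q <- perms (N - m) | indec Q && av3241_4321 Q)
      \sum_(x < lsites Q) phi (m - comps Z + nblues Q)%N (sites Z + x.+1)%N.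
Proof.
rewrite sum_perms_pre.
under eq_bigr => s _ do rewrite big_mkcond big_ord_recr -big_mkcond /=.
rewrite big_split /= addrC; congr (_ + _).
  rewrite [RHS]big_mkcond; rewrite big_seq_cond [RHS]big_seq_cond; apply: eq_bigr => s.
  rewrite andbT mem_perms => ws.
  rewrite (indec_pre_full ws) (cls_pre_full ws) (nblues_pre_full ws).
  by rewrite (lsites_pre ws (leqnn N) (indec_pre_full ws)) /sites (wf_size ws).
case: (posnP N) => [->|N0].
  by rewrite big_ord0 big1 // => s _; rewrite big_ord0.
rewrite sum_perms_dsum //; apply: eq_bigr => m _.
rewrite [RHS]big_mkcond big_seq_cond [RHS]big_seq_cond; apply: eq_bigr => Z.
rewrite andbT mem_perms => wZ.
move: (ltn_ord m) wZ; move: (nat_of_ord m) => {}m mN wZ.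
have [n EN] : exists n, N = (m + n)%N by exists (N - m)%N; rewrite subnKC // ltnW.
rewrite {N N0 mN}EN addKn.
(* If [Z] contains 321, heights above [m] are inadmissible, while heights up to [m] give
   decomposable words. *)
case: ifP => aZ; last first.
  rewrite big_seq_cond big1 // => Q /andP[]; rewrite mem_perms => wQ iQ.
  rewrite big_pred0 // => v; rewrite (indec_pre_dsum wZ wQ) //; last by have := ltn_ord v; lia.
  rewrite cls_pre; case: ltnP => //= mv; rewrite -(@subnKC m v); last by lia.
  by rewrite (admissible_dsumr wZ wQ) ?aZ ?andbF //; lia.
rewrite [RHS]big_mkcondr big_seq_cond [RHS]big_seq_cond; apply: eq_bigr => Q /andP[].
rewrite mem_perms => wQ iQ.
rewrite big_split_ord /= [X in X + _]big_pred0 ?add0r; last first.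
  by move=> v; rewrite (indec_pre_dsum wZ wQ) //=; have := ltn_ord v; lia.
transitivity (\sum_(u < n | [&& (0 < u)%N, av3241_4321 Q & admissible Q u])
   phi (m - comps Z + nblues Q)%N (sites Z + count (admissible Q) (iota 1 u))%N); last first.
  case: ifP => cQ; last by rewrite big_pred0 // => u; rewrite andbF.
  rewrite /lsites (wf_size wQ) -(sum_rank _ (fun x => phi _ (sites Z + x)%N)).
  exact: eq_bigl.
have E (u : 'I_n) : indec (pre (m + u) (dsum Z Q)) = (0 < u)%N.
  by rewrite (indec_pre_dsum wZ wQ) //; have := ltn_ord u; lia.
apply: eq_big => u.
  rewrite E cls_pre (cls_dsum wZ wQ); case: posnP => //= u0.
  by rewrite (admissible_dsumr wZ wQ) // aZ (av321_cls aZ).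
rewrite E cls_pre => /and3P[u0 cD]; rewrite (admissible_dsumr wZ wQ) // => /andP[_ okQ].
rewrite (nblues_pre_dsum wZ wQ) //; congr (phi _ _).
rewrite (lsites_pre (wf_dsum wZ wQ)) ?E //; last by have := ltn_ord u; lia.
by rewrite (count_admissible_dsum wZ wQ).
Qed.

(** Here [w] is the last component; avoiding 321, it has its full height as one site more than
    [lsites w]. *)
Lemma sum_av321_rec N (phi : nat -> nat -> R) :
  \sum_(Z <- perms N.+1 | av321 Z) phi (N.+1 - comps Z)%N (sites Z) =
  \sum_(m < N.+1) \sum_(Z <- perms m | av321 Z)
    \sum_(w <- perms (N - m).+1 | indec w && av321 w)
      phi (m - comps Z + (N - m))%N (sites Z + (lsites w).+1)%N.
Proof.
rewrite big_mkcond sum_perms_dsum //; apply: eq_bigr => m _.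
rewrite (subSn (ltn_ord m : m <= N)%N).
rewrite [RHS]big_mkcond big_seq_cond [RHS]big_seq_cond; apply: eq_bigr => Z.
rewrite andbT mem_perms => wZ.
case: ifP => aZ; last first.
  rewrite big_seq_cond big1 // => w /andP[]; rewrite mem_perms => ww _.
  by rewrite (av321_dsum wZ ww) aZ.
rewrite [RHS]big_mkcondr big_seq_cond [RHS]big_seq_cond; apply: eq_bigr => w /andP[].
rewrite mem_perms => ww iw; rewrite (av321_dsum wZ ww) aZ /=; case: ifP => // aw.
rewrite (comps_dsum wZ ww) (comps_indec iw); congr (phi _ _).
  by have := comps_le wZ; have := ltn_ord m; lia.
rewrite -(sites_av321 ww aw) -(count_admissible_dsum wZ ww _ aZ) /sites size_dsum.
by rewrite (wf_size wZ) (wf_size ww).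
Qed.

End Sums.

(** * Generating functions *)

(* The coefficient of [z^k] in the [j]-th power of the Catalan series. *)
Fixpoint ballot (k j : nat) : nat :=
  if k is k'.+1 then \sum_(i < j) ballot k' i.+2 else 1.

Section Series.
Local Open Scope ring_scope.
Variables (R : comNzRingType) (M : nat).

Lemma sum_cauchy (t : R) (a : nat -> nat -> R) : t ^+ M.+1 = 0 ->
  \sum_(m < M.+1) \sum_(n < M.+1) t ^+ m * t ^+ n * a m n =
  \sum_(N < M.+1) t ^+ N * \sum_(m < N.+1) a m (N - m)%N.
Proof.
move=> tM.
transitivity (\sum_(m < M.+1) \sum_(n < M.+1) \sum_(N < M.+1 | N == (m + n)%N :> nat) t ^+ N * a m n).
  apply: eq_bigr => m _; apply: eq_bigr => n _.
  rewrite -exprD; case: (ltnP (m + n) M.+1) => h.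
    by rewrite (big_pred1 (Ordinal h)) // => N; rewrite /= -val_eqE.
  rewrite (expt_ge tM) ?mul0r; last by lia.
  by rewrite big_pred0 // => N; have := ltn_ord N; lia.
under eq_bigr => m _ do rewrite (exchange_big_dep predT) //=.
rewrite exchange_big /=; apply: eq_bigr => N _; rewrite mulr_sumr.
rewrite (big_ord_widen M.+1 (fun m => t ^+ N * a m (N - m)%N)) ?ltn_ord //.
rewrite [RHS]big_mkcond; apply: eq_bigr => m _; case: ifP => mN; last first.
  by rewrite big_pred0 // => n; move: mN; lia.
have h : (N - m < M.+1)%N by have := ltn_ord N; lia.
by rewrite (big_pred1 (Ordinal h)) // => n; rewrite /= -val_eqE /=; lia.
Qed.

Lemma sum_cauchy_shift (t : R) (a : nat -> nat -> R) : t ^+ M.+1 = 0 ->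
  t * \sum_(m < M.+1) \sum_(n < M.+1) t ^+ m * t ^+ n * a m n =
  \sum_(N < M.+1) t ^+ N * \sum_(m < N) a m (N - m).-1.
Proof.
move=> tM; rewrite sum_cauchy // [RHS]big_ord_recl big_ord_recr big_ord0 mulr0 add0r /= mulrDr.
rewrite mulrA -exprS tM mul0r addr0 mulr_sumr; apply: eq_bigr => N _.
rewrite mulrA -exprS /bump leq0n add1n; congr (_ * _); apply: eq_bigr => m _.
by rewrite subSn // -ltnS.
Qed.

(** The exponent of [t] is the length minus one, whereas in [av321_gf] it is the length. *)
Definition indec_gf (t y : R) (f : nat -> R) : R :=
  \sum_(N < M.+1) t ^+ N *
    \sum_(X <- perms N.+1 | indec X && av3241_4321 X) y ^+ nblues X * f (lsites X).

(** The exponent [n - comps Z] counts the entries that a leading maximum turns blue. *)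
Definition av321_gf (t y : R) (g : nat -> R) : R :=
  \sum_(n < M.+1) t ^+ n *
    \sum_(Z <- perms n | av321 Z) y ^+ (n - comps Z) * g (sites Z).

Lemma indec_gf_rec t y f : t ^+ M.+1 = 0 ->
  indec_gf t y f = av321_gf t y f +
    t * av321_gf t y (fun a => indec_gf t y (fun d => \sum_(x < d) f (a + x.+1)%N)).
Proof.
move=> tM; rewrite /indec_gf.
under eq_bigr => N _ do
  rewrite (sum_class_rec N (fun k d => y ^+ k * f d)) mulrDr.
rewrite big_split /=; congr (_ + _).
pose b m n := \sum_(Z <- perms m | av321 Z) \sum_(Q <- perms n.+1 | indec Q && av3241_4321 Q)
  \sum_(x < lsites Q) y ^+ (m - comps Z + nblues Q) * f (sites Z + x.+1)%N.
transitivity (\sum_(N < M.+1) t ^+ N * \sum_(m < N) b m (N - m).-1).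
  apply: eq_bigr => N _; congr (_ * _); apply: eq_bigr => m _.
  by rewrite /b prednK //; have := ltn_ord m; lia.
rewrite -(sum_cauchy_shift _ tM); congr (_ * _); apply: eq_bigr => m _.
under eq_bigr => n _ do rewrite -mulrA.
rewrite -mulr_sumr; congr (_ * _).
under eq_bigr => n _ do rewrite mulr_sumr.
rewrite exchange_big /=; apply: eq_bigr => Z _; rewrite mulr_sumr; apply: eq_bigr => n _.
rewrite mulrCA; congr (_ * _); rewrite mulr_sumr; apply: eq_bigr => Q _.
by rewrite !mulr_sumr; apply: eq_bigr => x _; rewrite exprD mulrA.
Qed.

(** Setting [y] to 0 keeps the words without blue entries, those avoiding 321. A last component of
    length n + 1 has n entries besides its minimum, whence the argument [t * y]. *)
Lemma av321_gf_rec t y g : t ^+ M.+1 = 0 ->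
  av321_gf t y g = g 0 + t * av321_gf t y (fun a => indec_gf (t * y) 0 (fun d => g (a + d.+1)%N)).
Proof.
move=> tM.
pose b m n := \sum_(Z <- perms m | av321 Z) \sum_(w <- perms n.+1 | indec w && av321 w)
  y ^+ (m - comps Z + n) * g (sites Z + (lsites w).+1)%N.
transitivity (g 0 + \sum_(N < M.+1) t ^+ N * \sum_(m < N) b m (N - m).-1).
  rewrite /av321_gf big_ord_recl [in RHS]big_ord_recl big_ord0 mulr0 add0r; congr (_ + _).
    rewrite big_cons big_nil addr0 !mul1r ifT ?mul1r //.
    by apply/asboolP => i j k _ _.
  apply: eq_bigr => N _; rewrite lift0; congr (_ * _).
  rewrite (sum_av321_rec N (fun k d => y ^+ k * g d)); apply: eq_bigr => m _.
  by rewrite subSn //; have := ltn_ord m; lia.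
congr (_ + _); rewrite -(sum_cauchy_shift _ tM); congr (_ * _); apply: eq_bigr => m _.
under eq_bigr => n _ do rewrite -mulrA.
rewrite -mulr_sumr; congr (_ * _).
under eq_bigr => n _ do rewrite mulr_sumr.
rewrite exchange_big /=; apply: eq_bigr => Z _; rewrite mulr_sumr; apply: eq_bigr => n _.
rewrite exprMn mulrCA -mulrA; congr (_ * _); rewrite !mulr_sumr [RHS]big_mkcond [LHS]big_mkcond.
apply: eq_bigr => w _; rewrite expr0n nblues_eq0; case: (indec w) => //=.
have [aw|_] := boolP (av321 w); last by rewrite mul0r !mulr0; case: ifP.
by rewrite (av321_cls aw) exprD mul1r mulrCA mulrA.
Qed.

Lemma indec_gf0 f : indec_gf 0 0 f = f 0.
Proof.
rewrite /indec_gf big_ord_recl [X in _ + X]big1 ?addr0 => [|i _]; last by rewrite lift0 exprS !mul0r.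
rewrite (sum_class_rec 0 (fun k d => 0 ^+ k * f d)) big_ord0 addr0 mul1r.
by rewrite big_cons big_nil addr0 ifT ?mul1r //; apply/asboolP => i j k _ _.
Qed.

(** Each system takes its coefficients from the one solved before: [indec_gf 0 0], [av321_gf c 0],
    [indec_gf c 0], [av321_gf t y], and finally [indec_gf t y]. *)
Lemma indec_gf_solve t y C D : t ^+ M.+1 = 0 -> C = 1 + t * y * C ^+ 2 -> D = 1 + t * C * D ^+ 2 ->
  indec_gf t y (fun _ => 1) = D.
Proof.
move=> tM EC ED; set c := t * y in EC.
have cM : c ^+ M.+1 = 0 by rewrite exprMn tM mul0r.
have pow0 (h : nat -> R) : \sum_(d < M.+1) 0 ^+ d * h d = h 0.
  by rewrite big_ord_recl mul1r big1 ?addr0 // => i _; rewrite expr0n mul0r.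
have W0 g : av321_gf c 0 g = \sum_(a < M.+1) omega c 0 a * g a.
  apply: (omega_solve cM) => {}g; rewrite av321_gf_rec // mulr0; congr (_ + _ * av321_gf _ _ _).
  by apply/funext => a; rewrite indec_gf0 (pow0 (fun d => g (a + d.+1)%N)).
(* Here [k = 0] and [cc] and [J] are both [C], so [nu d] is [(c * C) ^+ d]. *)
have V0 f : indec_gf c 0 f = \sum_(d < M.+1) (c * C) ^+ d * f d.
  rewrite (@nu_solve _ _ c 0 cM C C _ _ (indec_gf c 0)) ?mulr0 ?add0r.
  - apply: eq_bigr => -[[|d] /= _] _ //.
    by rewrite mulr0 add0r exprS.
  - by rewrite mulrBl mul1r -mulrA {1}EC; ring.
  - by rewrite {1}EC; ring.
  - by move=> {}f; rewrite indec_gf_rec // !W0.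
have W1 g : av321_gf t y g = \sum_(a < M.+1) omega t (y * C) a * g a.
  apply: (omega_solve tM) => {}g; rewrite av321_gf_rec //; congr (_ + _ * av321_gf _ _ _).
  by apply/funext => a; rewrite V0 mulrA.
(* The last system has [k = y * C], [cc = D] and [J = C * D]. *)
have gJ : (1 - (t * (y * C) + t * D)) * (C * D) = 1.
  transitivity (C * D - c * C ^+ 2 * D - t * C * D ^+ 2); first by rewrite /c; ring.
  by rewrite {1}EC [D in X in X - _ = _]ED; ring.
have DJ : D - 1 = t * D * (C * D) by rewrite {1}ED; ring.
rewrite (nu_solve tM gJ DJ (V := indec_gf t y)) => [|f]; last by rewrite indec_gf_rec // !W1.
under eq_bigr do rewrite mulr1.
exact: (nu_sum tM gJ DJ).
Qed.

(** * Powers of the Catalan series *)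

Definition ballot_series (z : R) (j : nat) : R := \sum_(k < M.+1) (ballot k j)%:R * z ^+ k.

Lemma ballot_series0 z : ballot_series z 0 = 1.
Proof.
rewrite /ballot_series big_ord_recl mulr1 big1 ?addr0 // => i _.
by rewrite lift0 /= big_ord0 mul0r.
Qed.

Lemma ballot_seriesS z j : z ^+ M.+1 = 0 ->
  ballot_series z j.+1 = ballot_series z j + z * ballot_series z j.+2.
Proof.
move=> zM.
have E i : ballot_series z i = 1 + \sum_(k < M) (ballot k.+1 i)%:R * z ^+ k.+1.
  by rewrite /ballot_series big_ord_recl mulr1.
have -> : z * ballot_series z j.+2 = \sum_(k < M) (ballot k j.+2)%:R * z ^+ k.+1.
  rewrite /ballot_series big_ord_recr mulrDr /= [z * (_ * _)]mulrCA -exprS zM mulr0 addr0.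
  by rewrite mulr_sumr; apply: eq_bigr => k _; rewrite mulrCA -exprS.
rewrite !E -addrA -big_split; congr (_ + _); apply: eq_bigr => k _.
by rewrite /= big_ord_recr natrD mulrDl.
Qed.

(** Writing B_j for the series, the defects E_j = B_(j+1) - B_1 B_j satisfy E_0 = 0 and E_(j+1) =
    E_j + z E_(j+2). Hence divisibility of all of them by z^n improves to z^(n+1). *)
Lemma ballot_seriesX z j : z ^+ M.+1 = 0 -> ballot_series z j = ballot_series z 1 ^+ j.
Proof.
move=> zM; elim: j => [|j IH]; first exact: ballot_series0.
rewrite exprS -IH {IH}; apply/eqP; rewrite -subr_eq0; apply/eqP.
suff dvd n : forall j, exists r,
    ballot_series z j.+1 - ballot_series z 1 * ballot_series z j = z ^+ n * r.
  by have [r ->] := dvd M.+1 j; rewrite zM mul0r.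
elim: n => [|n IH] {}j; first by eexists; rewrite mul1r.
elim: j => [|j [r Hr]]; first by exists 0; rewrite ballot_series0 mulr1 subrr mulr0.
have [q Hq] := IH j.+2; exists (r + q).
rewrite (ballot_seriesS j.+1 zM) [X in _ - _ * X](ballot_seriesS j zM).
transitivity ((ballot_series z j.+1 - ballot_series z 1 * ballot_series z j)
  + z * (ballot_series z j.+3 - ballot_series z 1 * ballot_series z j.+2)); first by ring.
by rewrite Hr Hq exprS; ring.
Qed.

Lemma ballot_series_eqn z : z ^+ M.+1 = 0 ->
  ballot_series z 1 = 1 + z * ballot_series z 1 ^+ 2.
Proof. by move=> zM; rewrite -(ballot_seriesX 2 zM) ballot_seriesS // ballot_series0. Qed.

(** With C the Catalan series at [t * y], D is the Catalan series at [t * C]; the powers of C in its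
    terms are expanded by [ballot] once more. *)
Lemma nblues_gf (t y : R) : t ^+ M.+1 = 0 ->
  \sum_(N < M.+1) t ^+ N * \sum_(X <- perms N.+1 | indec X && av3241_4321 X) y ^+ nblues X =
  \sum_(N < M.+1) t ^+ N *
    \sum_(m < N.+1) (ballot m 1 * ballot (N - m) m)%N%:R * y ^+ (N - m).
Proof.
move=> tM; have cM : (t * y) ^+ M.+1 = 0 by rewrite exprMn tM mul0r.
have EC := ballot_series_eqn cM; set C := ballot_series _ _ in EC.
have tCM : (t * C) ^+ M.+1 = 0 by rewrite exprMn tM mul0r.
have := indec_gf_solve tM EC (ballot_series_eqn tCM).
rewrite /indec_gf; under eq_bigr => N _ do under eq_bigr => X _ do rewrite mulr1.
move=> ->; rewrite -(sum_cauchy (fun m n => (ballot m 1 * ballot n m)%N%:R * y ^+ n) tM).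
apply: eq_bigr => m _; rewrite exprMn /C -ballot_seriesX // mulrCA mulr_sumr mulr_sumr.
by apply: eq_bigr => n _; rewrite exprMn natrM; ring.
Qed.

End Series.

(** * Extraction of coefficients *)

Section Extract.
Local Open Scope ring_scope.

(* The hypothesis is used for [R = A[X]/(X^(M+1))]. *)
Lemma eq_coef_nilpotent (A : comNzRingType) (M : nat) (a b : nat -> A) :
  (forall (R : comNzRingType) (io : {rmorphism {poly A} -> R}), io 'X ^+ M.+1 = 0 ->
     \sum_(N < M.+1) io 'X ^+ N * io (a N)%:P = \sum_(N < M.+1) io 'X ^+ N * io (b N)%:P) ->
  forall N, (N < M.+1)%N -> a N = b N.
Proof.
move=> H N NM.
have /H : in_qpoly ('X^(M.+1) : {poly A}) 'X ^+ M.+1 = 0.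
  rewrite -rmorphXn; apply/val_inj; rewrite /= mk_monic_Xn /=.
  by rewrite Pdiv.RingMonic.rmodpp ?monicXn.
have sumE (c : nat -> A) : \sum_(N < M.+1) in_qpoly ('X^(M.+1) : {poly A}) 'X ^+ N * in_qpoly _ (c N)%:P
    = in_qpoly ('X^(M.+1) : {poly A}) (\poly_(N < M.+1) c N).
  rewrite poly_def rmorph_sum; apply: eq_bigr => i _.
  by rewrite -rmorphXn -rmorphM /= -mul_polyC mulrC.
(* Both polynomials have degree at most [M], so reduction leaves them unchanged. *)
rewrite /= !sumE => /(congr1 val) /=; rewrite !Pdiv.Ring.rmodp_small => [/polyP/(_ N)||];
  rewrite ?mk_monic_Xn ?size_polyXn ?ltnS ?size_poly //.
by rewrite !coef_poly NM.
Qed.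

End Extract.

Lemma count_class N k : k <= N ->
  count (fun X => [&& indec X, av3241_4321 X & nblues X == k]) (perms N.+1) =
  ballot (N - k) 1 * ballot k (N - k).
Proof.
move=> kN.
(* The indeterminate of [{poly int}] plays [y]; the outer one, made nilpotent in [R], plays [t]. *)
pose a n : {poly int} := (\sum_(X <- perms n.+1 | indec X && av3241_4321 X) 'X ^+ nblues X)%R.
pose b n : {poly int} := (\sum_(m < n.+1) (ballot m 1 * ballot (n - m) m)%N%:R * 'X ^+ (n - m))%R.
have : a N = b N.
  apply: (@eq_coef_nilpotent _ N) => // R io tM.
  have := nblues_gf (io ('X%:P)%R) tM; congr (_ = _); apply: eq_bigr => n _; congr (_ * _)%R.
    rewrite /a !rmorph_sum; apply: eq_bigr => X _; by rewrite !rmorphXn.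
  rewrite /b !rmorph_sum; apply: eq_bigr => m _.
  by rewrite !rmorphM !rmorphXn !rmorph_nat.
move/(congr1 (fun p : {poly int} => p`_k)%R).
rewrite /a /b !coef_sum.
under eq_bigr => X _ do rewrite coefXn.
under [in RHS]eq_bigr => m _ do rewrite -polyC_natr coefCM coefXn.
(* The coefficient of degree [k] selects the single term [m = N - k]. *)
have h : N - k < N.+1 by lia.
rewrite (bigD1 (Ordinal h)) //= subKn // eqxx mulr1 [X in (_ + X)%R]big1 ?addr0 => [|m]; last first.
  by rewrite -val_eqE /= => mk; rewrite (_ : (k == N - m) = false) ?mulr0 //; have := ltn_ord m; lia.
have <- : ((count (fun X => [&& indec X, av3241_4321 X & nblues X == k]) (perms N.+1))%:R =
    \sum_(X <- perms N.+1 | indec X && av3241_4321 X) (k == nblues X)%:R :> int)%R.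
  rewrite -sum1_count natr_sum big_mkcond [RHS]big_mkcond; apply: eq_bigr => X _.
  by rewrite eq_sym; case: (indec X); case: (av3241_4321 X); case: (_ == _).
by move/eqP; rewrite Num.Theory.eqr_nat => /eqP.
Qed.

(** * Transfer to permutations and the bijection *)

Section Word.
Variables (n : nat) (p : {perm 'I_n}).

Definition word : seq nat := [seq val (p i) | i <- enum 'I_n].

Lemma size_word : size word = n.
Proof. by rewrite size_map size_enum_ord. Qed.

Lemma nth_word (i : 'I_n) : word`[i] = p i.
Proof. by rewrite (nth_map i) ?size_enum_ord // nth_ord_enum. Qed.

Lemma wf_word : wf n word.
Proof.
rewrite /wf size_word eqxx map_inj_uniq ?enum_uniq => [|i j /val_inj /perm_inj //].
by apply/allP => x /mapP[i _ ->] /=; apply: ltn_ord.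
Qed.

Lemma occurrence321 (i j k : 'I_n) :
  occurrence p [:: 3; 2; 1] [:: i; j; k] = [&& i < j, j < k, p k < p j & p j < p i].
Proof. by rewrite /occurrence /=; apply/idP/idP; lia. Qed.

Lemma occurrence3241 (i j k l : 'I_n) : occurrence p [:: 3; 2; 4; 1] [:: i; j; k; l] =
  [&& i < j, j < k, k < l, p l < p j, p j < p i & p i < p k].
Proof. by rewrite /occurrence /=; apply/idP/idP; lia. Qed.

Lemma occurrence4321 (i j k l : 'I_n) : occurrence p [:: 4; 3; 2; 1] [:: i; j; k; l] =
  [&& i < j, j < k, k < l, p l < p k, p k < p j & p j < p i].
Proof. by rewrite /occurrence /=; apply/idP/idP; lia. Qed.

Lemma occurrence4312 (i j k l : 'I_n) : occurrence p [:: 4; 3; 1; 2] [:: i; j; k; l] =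
  [&& i < j, j < k, k < l, p k < p l, p l < p j & p j < p i].
Proof. by rewrite /occurrence /=; apply/idP/idP; lia. Qed.

Lemma avoids321_word : avoids p [:: 3; 2; 1] = av321 word.
Proof.
apply/existsPn/asboolP => [H i j k ij jk|H t]; rewrite ?size_word.
  move=> kn; have jn : j < n by lia.
  have i_n : i < n by lia.
  have := H [tuple Ordinal i_n; Ordinal jn; Ordinal kn]; rewrite occurrence321 /=.
  by have := (nth_word (Ordinal i_n), nth_word (Ordinal jn), nth_word (Ordinal kn)) => /= -[[-> ->] ->]; lia.
case: t => -[|i [|j [|k []]]] //= _; rewrite occurrence321 -!nth_word; apply/negP => /and4P[ij jk h1 h2].
by apply: (H i j k) => //; rewrite size_word.
Qed.

Lemma cls_word : avoids p [:: 3; 2; 4; 1] && avoids p [:: 4; 3; 2; 1] = av3241_4321 word.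
Proof.
apply/andP/asboolP => [[/existsPn H1 /existsPn H2] i j k l ij jk kl|H].
  rewrite size_word => ln; have kn : k < n by lia.
  have jn : j < n by lia.
  have i_n : i < n by lia.
  have := H1 [tuple Ordinal i_n; Ordinal jn; Ordinal kn; Ordinal ln].
  have := H2 [tuple Ordinal i_n; Ordinal jn; Ordinal kn; Ordinal ln].
  rewrite occurrence3241 occurrence4321 -!nth_word /=; lia.
split; apply/existsPn => -[[|i [|j [|k [|l []]]]] //= _];
  rewrite ?occurrence3241 ?occurrence4321 -!nth_word; apply/negP => h;
  have := H i j k l; rewrite size_word ltn_ord; lia.
Qed.

Lemma indec_word : indecomposable p = indec word.
Proof.
apply/andP/indecP; rewrite size_word => -[n0 H]; split=> //.
  move=> k k0 kn /cutP H'; move/forallP/(_ (Ordinal kn)): H; rewrite /= k0 /=.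
  case/negP; apply/forallP => i; apply/implyP => ik.
  by have := H' i ik; rewrite nth_word.
apply/forallP => k; apply/implyP => k0; apply/negP => /forallP H'.
apply: (H k) => //; apply/cutP => i ik.
have i_n : i < n by rewrite (ltn_trans ik).
by have := H' (Ordinal i_n); rewrite /= ik; have /= -> := nth_word (Ordinal i_n).
Qed.

Lemma blue_word (j : 'I_n) : blue p j = blue_at word j.
Proof.
apply/orP/asboolP.
  case=> /existsP[]; [move=> [[|i [|j' [|k []]]] //= _]|move=> [[|a [|b [|c [|j' []]]]] //= _]];
    rewrite ?occurrence321 ?occurrence4312 -!nth_word => /andP[+ /eqP Ej]; rewrite Ej => h.
    by left; exists i, k; rewrite size_word ltn_ord; split; lia.
  by right; exists a, b, c; do 2?split; lia.
case=> [[i [k []]]|[a [b [c [ab bc cj []]]]]].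
  rewrite size_word => ij jk kn h1 h2; left; apply/existsP.
  have i_n : i < n by have := ltn_ord j; lia.
  exists [tuple Ordinal i_n; j; Ordinal kn].
  by rewrite occurrence321 -!nth_word /= eqxx andbT; lia.
move=> h1 h2 h3; right; apply/existsP.
have an : a < n by have := ltn_ord j; lia.
have bn : b < n by have := ltn_ord j; lia.
have cn : c < n by have := ltn_ord j; lia.
exists [tuple Ordinal an; Ordinal bn; Ordinal cn; j].
by rewrite occurrence4312 -!nth_word /= eqxx andbT; lia.
Qed.

Lemma nblue_word : nblue p = nblues word.
Proof.
rewrite /nblue /nblues size_word cardsE -val_enum_ord count_map cardE size_filter.
by rewrite enumT; apply: eq_count => j; rewrite /= -blue_word.
Qed.

Lemma inI_nk_word k : inI_nk k p = [&& indec word, av3241_4321 word & nblues word == k].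
Proof. by rewrite /inI_nk /inI_3241_4321 indec_word cls_word nblue_word andbA. Qed.

Lemma inI_321_word : inI_321 p = [&& indec word, av3241_4321 word & nblues word == 0].
Proof.
rewrite /inI_321 indec_word avoids321_word nblues_eq0; congr (_ && _).
by rewrite andb_idl //; apply: av321_cls.
Qed.

End Word.

Lemma word_inj n : injective (@word n).
Proof.
move=> p q E; apply/permP => i; apply/val_inj.
by rewrite /= -!nth_word E.
Qed.

Lemma word_surj n s : wf n s -> exists p : {perm 'I_n}, word p = s.
Proof.
move=> ws; pose f (i : 'I_n) := Ordinal (wf_lt ws (ltn_ord i)).
have f_inj : injective f.
  by move=> i j [] /(wf_inj ws (ltn_ord i) (ltn_ord j)) /val_inj.
exists (perm f_inj); apply: (@eq_from_nth _ 0); rewrite size_word ?(wf_size ws) // => i i_n.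
by have := nth_word (perm f_inj) (Ordinal i_n); rewrite /= permE.
Qed.

(** * Bijections from enumerations *)

Lemma bijective_ord (T : choiceType) (U : eqType) (P : pred T) (g : T -> U) (l : seq U) :
  injective g -> uniq l -> (forall x, P x -> g x \in l) ->
  (forall u, u \in l -> exists2 x, P x & g x = u) ->
  exists f : {x | P x} -> 'I_(size l), bijective f.
Proof.
move=> g_inj ul gl lg.
have idx (x : {x | P x}) : index (g (val x)) l < size l by rewrite index_mem gl //; apply: valP.
exists (fun x => Ordinal (idx x)).
have ex (i : 'I_(size l)) : exists x : {x | P x}, index (g (val x)) l == i.
  have : 0 < size l by apply: leq_ltn_trans (ltn_ord i).
  rewrite -has_predT => /hasP[u0 _ _]; have [x Px gx] := lg _ (mem_nth u0 (ltn_ord i)).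
  by exists (exist _ x Px); rewrite /= gx index_uniq.
exists (fun i => xchoose (ex i)) => [x|i]; last first.
  by apply/val_inj/eqP; rewrite /= (eqP (xchooseP (ex i))).
apply/val_inj/g_inj; have /eqP := xchooseP (ex (Ordinal (idx x))).
rewrite [nat_of_ord _]/= => E.
by rewrite -(nth_index (g (val x)) (gl _ (valP _))) E nth_index // gl //; apply: valP.
Qed.

(** Indices below [b * c] are matched with pairs through the enumeration of the finite type
    ['I_b * 'I_c]. *)
Lemma bijective_prod (A B C : Type) b c :
  (exists f : A -> 'I_(b * c), bijective f) -> (exists f : B -> 'I_b, bijective f) ->
  (exists f : C -> 'I_c, bijective f) -> exists f : A -> B * C, bijective f.
Proof.
move=> [f [f' fK f'K]] [g [g' gK g'K]] [h [h' hK h'K]].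
have E : #|{: 'I_b * 'I_c}| = b * c by rewrite card_prod !card_ord.
pose d x := enum_val (cast_ord (esym E) (f x)).
exists (fun x => (g' (d x).1, h' (d x).2)).
exists (fun y => f' (cast_ord E (enum_rank (g y.1, h y.2)))) => [x|[y z]] /=.
  by rewrite g'K h'K -surjective_pairing enum_valK cast_ordKV fK.
by rewrite /d f'K cast_ordK enum_rankK /= gK hK.
Qed.

(** * The sequences described by [inC] *)

Fixpoint cseqs (k r : nat) : seq (seq nat) :=
  if k is k'.+1 then [seq a :: l | a <- iota 1 r.+1, l <- cseqs k' a] else [:: [::]].

(** After a first entry i + 1 the remaining entries are counted by [ballot k i.+2], as in the
    recursion of [ballot]. *)
Lemma size_cseqs k r : size (cseqs k r) = ballot k r.+1.
Proof.
elim: k r => // k IH r; rewrite [cseqs _ _]/(allpairs_dep _ _ _) size_allpairs_dep.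
rewrite sumnE big_map (_ : iota 1 r.+1 = map succn (iota 0 r.+1)); last by rewrite -(iotaDl 1).
rewrite big_map -[iota 0 _]/(index_iota 0 r.+1) big_mkord /=.
by apply: eq_bigr => i _; rewrite IH.
Qed.

Lemma uniq_cseqs k r : uniq (cseqs k r).
Proof.
elim: k r => // k IH r; apply: allpairs_uniq_dep => //; first exact: iota_uniq.
by move=> [a l] [a' l'] _ _ /= [-> ->].
Qed.

(** Prepending [r] as a virtual earlier entry makes the bound on the first entry an instance of the
    general one. *)
Lemma mem_cseqs k r l : (l \in cseqs k r) = (size l == k) &&
  all (fun i => (0 < l`[i]) && (l`[i] <= (r :: l)`[i].+1)) (iota 0 (size l)).
Proof.
elim: k r l => [|k IH] r [|a l].
- by [].
- by rewrite inE.
- by apply/negbTE/negP => /allpairsPdep[? [? []]].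
rewrite [size _]/= eqSS (_ : iota 0 (size l).+1 = 0 :: map succn (iota 0 (size l)));
  last by rewrite -(iotaDl 1).
rewrite [all _ _]/= all_map; apply/allpairsPdep/idP => [[a' [l' [+ + [-> ->]]]]|].
  rewrite mem_iota IH => h /andP[-> h']; rewrite h' andbT /=; lia.
move=> /and3P[sl h h']; exists a, l; split=> //; first by rewrite mem_iota; lia.
by rewrite IH sl.
Qed.

Lemma inC_cseqs k r (a : k.-tuple nat) : inC r a = (val a \in cseqs k r).
Proof.
rewrite mem_cseqs size_tuple eqxx /=; apply/forallP/allP => H i.
  rewrite mem_iota => /= ik; have := H (Ordinal ik); rewrite /= (tnth_nth 0) /=.
  by case: i ik => // i ik; rewrite (tnth_nth 0).
case: i => [[|i] ik]; rewrite (tnth_nth 0) /=; [move: (H 0)|move: (H i.+1)];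
  by rewrite mem_iota ik => /(_ isT).
Qed.

Theorem theorem3 (n k : nat) (hn : 2 <= n) (hk : k <= n - 2) :
  exists f : {p : {perm 'I_n} | inI_nk k p} ->
             {q : {perm 'I_(n - k)} | inI_321 q} *
             {a : k.-tuple nat | inC (n - k - 2) a},
    bijective f.
Proof.
(* Both sets of permutations are instances, with [j = k] and with [j = 0]. *)
have bij m j (P : pred {perm 'I_m.+1}) : j <= m ->
    (forall p, P p = [&& indec (word p), av3241_4321 (word p) & nblues (word p) == j]) ->
    exists f : {p | P p} -> 'I_(ballot (m - j) 1 * ballot j (m - j)), bijective f.
  move=> jm HP; rewrite -(count_class jm) -size_filter.
  apply: (bijective_ord (g := @word m.+1)); first exact: word_inj.
  - by rewrite filter_uniq ?perms_uniq.
  - by move=> p; rewrite HP mem_filter mem_perms wf_word andbT.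
  move=> s; rewrite mem_filter mem_perms => /andP[h /word_surj[p Ep]].
  by exists p; rewrite ?HP Ep.
have [m Em] : exists m, n = m.+1 by exists n.-1; lia.
have [r Er] : exists r, n - k = r.+2 by exists (n - k - 2); lia.
(* As n - 1 - k = r + 1, the count for [inI_nk] is the product of those of the two factors. *)
apply: (@bijective_prod _ _ _ (ballot r.+1 1) (ballot k r.+1)).
- subst n; have km : k <= m by lia.
  have E : m - k = r.+1 by lia.
  by have := bij m k (inI_nk k) km (fun p => inI_nk_word p k); rewrite E.
- rewrite Er; have := bij r.+1 0 (@inI_321 _) isT (@inI_321_word _).
  by rewrite subn0 muln1.
rewrite (_ : n - k - 2 = r); last by lia.
rewrite -size_cseqs; apply: (bijective_ord (g := val)); first exact: val_inj.
- exact: uniq_cseqs.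
- by move=> a; rewrite inC_cseqs.
move=> l ml; have := ml; rewrite mem_cseqs => /andP[sl _].
by exists (Tuple sl); rewrite ?inC_cseqs.
Qed.
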